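(* Let $(A,\rho,[\cdot,\cdot],g)$ be a pseudo-Riemannian skew algebroid, $\Pi$ an $A$-bivector field and $\xi$ an $A$-vector field, and let $\lambda=g(\xi,\xi)\flat_g(\xi)-\flat_g(J\xi)$. Assume that $\mathcal{L}^\rho_\xi\Pi=0$ and that the triple $(\Pi,\xi,g)$ is compatible. Then $(\Pi,\xi)$ is a Jacobi structure if and only if $(\xi-\sharp_\Pi(\lambda))\wedge\Pi=0$.
   Context: A skew algebroid on a smooth manifold $M$ is a vector bundle $A\to M$ with a vector bundle morphism $\rho:A\to TM$ (the anchor) and a skew-symmetric $\mathbb{R}$-bilinear bracket on $\Gamma(A)$ satisfying $[a,\varphi b]=\varphi[a,b]+(\rho(a)\cdot\varphi)b$. It is pseudo-Riemannian if $A$ carries a pseudo-Riemannian (nondegenerate symmetric) bundle metric $g$; $\flat_g(a)=g(a,\cdot)$, $\sharp_g=\flat_g^{-1}$, and $g^\star(\alpha,\beta)=g(\sharp_g(\alpha),\sharp_g(\beta))$ is the cometric on $A^\star$. An $A$-vector field is a section of $A$, an $A$-bivector field a section of $\wedge^2A$. Lie derivative: $\mathcal{L}^\rho_a\varphi=\rho(a)\cdot\varphi$, $(\mathcal{L}^\rho_a\eta)(a_1,\dots,a_k)=\rho(a)\cdot\eta(a_1,\dots,a_k)-\sum_i\eta(a_1,\dots,[a,a_i],\dots,a_k)$ for forms, $\langle\mathcal{L}^\rho_aP,\eta\rangle=\rho(a)\cdot\langle P,\eta\rangle-\langle P,\mathcal{L}^\rho_a\eta\rangle$ for multivector fields $P$;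 $d_\rho\varphi(a)=\rho(a)\cdot\varphi$. The Schouten–Nijenhuis bracket on $\Gamma(\wedge^\bullet A)$ is the unique $\mathbb{R}$-bilinear bracket with $[\varphi,\psi]=0$ for functions, $[a,P]=\mathcal{L}^\rho_aP$ for $a\in\Gamma(A)$, $[P,Q]=(-1)^{kl}[Q,P]$ and $[P,Q\wedge R]=[P,Q]\wedge R+(-1)^{(k+1)l}Q\wedge[P,R]$ for $P\in\Gamma(\wedge^kA)$, $Q\in\Gamma(\wedge^lA)$. Exterior products are normalised so that $(\xi\wedge\Pi)(\alpha,\beta,\gamma)=\alpha(\xi)\Pi(\beta,\gamma)+\beta(\xi)\Pi(\gamma,\alpha)+\gamma(\xi)\Pi(\alpha,\beta)$. $(\Pi,\xi)$ is a Jacobi structure if $[\Pi,\Pi]=2\xi\wedge\Pi$ and $\mathcal{L}^\rho_\xi\Pi=0$. $\sharp_\Pi:A^\star\to A$: $\beta(\sharp_\Pi(\alpha))=\Pi(\alpha,\beta)$; $[\alpha,\beta]_\Pi=\mathcal{L}^\rho_{\sharp_\Pi(\alpha)}\beta-\mathcal{L}^\rho_{\sharp_\Pi(\beta)}\alpha-d_\rho(\Pi(\alpha,\beta))$. Endomorphisms $J$ of $A$ and $J^\star$ of $A^\star$: $g(J\sharp_g(\alpha),\sharp_g(\beta))=\Pi(\alpha,\beta)=g^\star(J^\star\alpha,\beta)$. $\sharp_{\Pi,\xi}(\alpha)=\sharp_\Pi(\alpha)+\alpha(\xi)\xi$, $\rho_{\Pi,\xi}=\rho\circ\sharp_{\Pi,\xi}$,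 and with $\lambda=g(\xi,\xi)\flat_g(\xi)-\flat_g(J\xi)$, $$[\alpha,\beta]^g_{\Pi,\xi}=[\alpha,\beta]_\Pi+\alpha(\xi)(\mathcal{L}^\rho_\xi\beta-\beta)-\beta(\xi)(\mathcal{L}^\rho_\xi\alpha-\alpha)-\Pi(\alpha,\beta)\lambda.$$ The Levi-Civita connection of a pseudo-Riemannian skew algebroid is the unique affine connection $\nabla$ ($\mathbb{R}$-bilinear, $\nabla_{\varphi a}b=\varphi\nabla_ab$, $\nabla_a(\varphi b)=\varphi\nabla_ab+(\rho(a)\cdot\varphi)b$) with $\nabla_ab-\nabla_ba=[a,b]$ and $\rho(a)\cdot g(b,c)=g(\nabla_ab,c)+g(b,\nabla_ac)$. Let $\mathcal{D}$ be the Levi-Civita connection of the pseudo-Riemannian skew algebroid $(A^\star,\rho_{\Pi,\xi},[\cdot,\cdot]^g_{\Pi,\xi},g^\star)$, and $\mathcal{D}\Pi(\alpha,\beta,\gamma)=\rho_{\Pi,\xi}(\alpha)\cdot\Pi(\beta,\gamma)-\Pi(\mathcal{D}_\alpha\beta,\gamma)-\Pi(\beta,\mathcal{D}_\alpha\gamma)$. The triple $(\Pi,\xi,g)$ is compatible if for all $\alpha,\beta,\gamma\in\Gamma(A^\star)$ $$\mathcal{D}\Pi(\alpha,\beta,\gamma)=\tfrac12\big(\gamma(\xi)\Pi(\alpha,\beta)-\beta(\xi)\Pi(\alpha,\gamma)-(J^\star\gamma)(\xi)\,g^\star(\alpha,\beta)+(J^\star\beta)(\xi)\,g^\star(\alpha,\gamma)\big).$$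 *)

(* Defs.v *)
From HB Require Import structures.
From mathcomp Require Import all_boot all_order all_algebra.
From mathcomp Require Import all_classical all_reals all_analysis.
Set Implicit Arguments.
Unset Strict Implicit.
Unset Printing Implicit Defensive.
Import Order.TTheory GRing.Theory Num.Theory.
Import numFieldNormedType.Exports.
Local Open Scope classical_set_scope.
Local Open Scope ring_scope.

(* For [U] open: every iterated directional derivative of [f] exists and is
   Frechet differentiable (hence continuous) on [U], i.e. [f] is C^oo there. *)
Definition smooth_on (R : realType) (V W : normedModType R) (U : set V)
    (f : V -> W) : Prop :=
  forall (vs : seq V) (x : V), U x ->
    differentiable (foldr (fun v h => 'D_v h) f vs) x.

Lemma near_eq_differentiable (R : realType) (V W : normedModType R)
    (f g : V -> W) (x : V) :
  (\forall y \near x, f y = g y) -> differentiable f x -> differentiable g x.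
Proof.
move=> fg /diff_locallyP[dfc dfE].
have gE : g \o shift x = cst (g x) + 'd f x +o_ 0 id.
  apply/eqaddoP => e e0.
  have fg0 : \forall h \near 0, f (h + x) = g (h + x).
    by move: fg; rewrite (near_shift 0) subr0.
  move/eqaddoP: dfE => /(_ e e0); apply: filterS2 fg0 => h fgh.
  by rewrite /= !fctE /= fgh (nbhs_singleton fg).
by apply/diff_locallyP; rewrite (diff_unique dfc gE).
Qed.

Lemma eq_smooth_on (R : realType) (V W : normedModType R) (U : set V)
    (f g : V -> W) :
  open U -> (forall x, U x -> f x = g x) -> smooth_on U f -> smooth_on U g.
Proof.
move=> oU fg sf vs x Ux; apply: near_eq_differentiable (sf vs x Ux).
have nU y : U y -> \forall z \near y, U z by move=> Uy; exact: open_nbhs_nbhs.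
apply: filterS (nU x Ux) => {x Ux}.
elim: vs => [|v vs IH] //= y Uy.
by apply: near_eq_derive; apply: filterS (nU y Uy).
Qed.

(* Charts and their inverses are total functions, meaningful only on
   [chart_dom i] and on its image. *)
Record smooth_manifold (R : realType) (n : nat) := SmoothManifold {
  carrier :> topologicalType;
  chart_index : Type;
  chart_dom : chart_index -> set carrier;
  chart : chart_index -> carrier -> 'rV[R]_n;
  chart_inv : chart_index -> 'rV[R]_n -> carrier;
  manifold_hausdorff : hausdorff_space carrier;
  manifold_second_countable : @second_countable carrier;
  chart_dom_open : forall i, open (chart_dom i);
  chart_cover : forall x, exists i, chart_dom i x;
  chart_img_open : forall i, open (chart i @` chart_dom i);
  chartK : forall i x, chart_dom i x -> chart_inv i (chart i x) = x;
  chart_continuous : forall i x, chart_dom i x -> {for x, continuous (chart i)};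
  chart_inv_continuous : forall i y, (chart i @` chart_dom i) y ->
    {for y, continuous (chart_inv i)};
  chart_smooth : forall i j,
    smooth_on (chart i @` (chart_dom i `&` chart_dom j))
              (chart j \o chart_inv i) }.

Definition smooth_in (R : realType) (n : nat) (M : smooth_manifold R n)
    (U : set M) (f : M -> R) : Prop :=
  forall i : chart_index M,
    smooth_on (chart i @` (chart_dom i `&` U)) (f \o chart_inv i : _ -> R^o).

Definition smooth_fun (R : realType) (n : nat) (M : smooth_manifold R n)
    (f : M -> R) : Prop := smooth_in setT f.

Lemma chart_img_openI (R : realType) (n : nat) (M : smooth_manifold R n)
    (U : set M) (i : chart_index M) :
  open U -> open (chart i @` (chart_dom i `&` U)).
Proof.
move=> oU; rewrite openE => _ [x [ix Ux] <-].
have cix : (chart i @` chart_dom i) (chart i x) by exists x.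
have nV : \forall y \near chart i x, (chart i @` chart_dom i) y.
  by apply: open_nbhs_nbhs; split=> //; exact: chart_img_open.
have nU : \forall y \near chart i x, U (chart_inv i y).
  apply: (chart_inv_continuous cix).
  by rewrite /= chartK //; apply: open_nbhs_nbhs.
rewrite /interior; apply: filterS2 nV nU => y [z iz <-].
by rewrite chartK // => Uz; exists z.
Qed.

Lemma eq_smooth_in (R : realType) (n : nat) (M : smooth_manifold R n)
    (U : set M) (f g : M -> R) :
  open U -> (forall x, U x -> f x = g x) -> smooth_in U f -> smooth_in U g.
Proof.
move=> oU fg sf i; apply: eq_smooth_on (sf i); first exact: chart_img_openI.
by move=> _ [x [ix Ux] <-] /=; rewrite chartK // fg.
Qed.

(* Tangent vectors at [x] are the derivations at [x] of the algebra C^oo(M). *)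
Record tangent_at (R : realType) (n : nat) (M : smooth_manifold R n) (x : M)
    (D : (M -> R) -> R) : Prop := TangentAt {
  tangent_linear : forall (c : R) (f h : M -> R), smooth_fun f -> smooth_fun h ->
    D (fun y => c * f y + h y) = c * D f + D h;
  tangent_leibniz : forall f h : M -> R, smooth_fun f -> smooth_fun h ->
    D (fun y => f y * h y) = f x * D h + h x * D f }.

(* Local trivialisations are given by local frames; their transition matrices
   are smooth. *)
Record vector_bundle (R : realType) (n : nat) (M : smooth_manifold R n) :=
    VectorBundle {
  fiber :> M -> vectType R;
  rank : nat;
  triv_index : Type;
  triv_dom : triv_index -> set M;
  frame : triv_index -> forall x : M, rank.-tuple (fiber x);
  triv_dom_open : forall i, open (triv_dom i);
  triv_cover : forall x, exists i, triv_dom i x;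
  frame_basis : forall i x, triv_dom i x -> basis_of fullv (frame i x);
  frame_smooth : forall i j (k l : 'I_rank),
    smooth_in (triv_dom i `&` triv_dom j)
              (fun x => coord (frame j x) l (frame i x)`_k) }.

Section DualBundle.
Context (R : realType) (n : nat) (M : smooth_manifold R n).
Context (A : vector_bundle M).

Definition coframe (i : triv_index A) (x : M) :
    (rank A).-tuple 'Hom(A x, R^o) :=
  [tuple linfun (coord (frame i x) k : A x -> R^o) | k < rank A].

Lemma coframeE i x (k : 'I_(rank A)) v :
  (coframe i x)`_k v = coord (frame i x) k v.
Proof. by rewrite -tnth_nth tnth_mktuple lfunE. Qed.

Lemma coframe_expand i x (a : 'Hom(A x, R^o)) : triv_dom i x ->
  a = \sum_(k < rank A) a (frame i x)`_k *: (coframe i x)`_k.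
Proof.
move=> ix; apply/lfunP => v.
have := coord_basis (frame_basis ix) (memvf v) => {1}->.
rewrite linear_sum sum_lfunE; apply: eq_bigr => k _.
by rewrite linearZ /= lfunE /= coframeE /GRing.scale /= mulrC.
Qed.

Lemma coframe_basis i x : triv_dom i x -> basis_of fullv (coframe i x).
Proof.
move=> ix; have eB := frame_basis ix.
have cf : free (coframe i x).
  apply/freeP => c /lfunP c0 l.
  have := c0 (frame i x)`_l; rewrite sum_lfunE lfunE /= (bigD1 l) //= big1.
    rewrite lfunE /= coframeE coord_free ?(basis_free eB) // eqxx addr0.
    by rewrite /GRing.scale /= mulr1.
  move=> k kl; rewrite lfunE /= coframeE coord_free ?(basis_free eB) //.
  by rewrite eq_sym (negbTE kl) scaler0.
have dimH : \dim {: 'Hom(A x, R^o)} = \dim {: A x} by rewrite !dimvf; exact: muln1.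
by rewrite basisEfree cf subvf dimH size_tuple (size_basis eB) leqnn.
Qed.

Lemma coframe_coord i j x (k l : 'I_(rank A)) :
  (triv_dom i `&` triv_dom j) x ->
  coord (coframe j x) l (coframe i x)`_k = coord (frame i x) k (frame j x)`_l.
Proof.
move=> [ix jx]; rewrite {1}(coframe_expand (coframe i x)`_k jx).
by rewrite coord_sum_free ?(basis_free (coframe_basis jx)) // coframeE.
Qed.

Lemma coframe_smooth i j (k l : 'I_(rank A)) :
  smooth_in (triv_dom i `&` triv_dom j)
            (fun x => coord (coframe j x) l (coframe i x)`_k).
Proof.
have oU : open (@triv_dom _ _ _ A i `&` triv_dom j).
  by apply: openI; exact: triv_dom_open.
apply: eq_smooth_in (oU) _ _.
  by move=> x ijx; rewrite coframe_coord.
by rewrite setIC; exact: frame_smooth.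
Qed.

Definition dual_bundle : vector_bundle M :=
  VectorBundle (@triv_dom_open _ _ _ A) (@triv_cover _ _ _ A)
    coframe_basis coframe_smooth.

End DualBundle.

Definition section (R : realType) (n : nat) (M : smooth_manifold R n)
  (E : vector_bundle M) : Type := forall x : M, E x.

Definition smooth_section (R : realType) (n : nat) (M : smooth_manifold R n)
    (E : vector_bundle M) (a : section E) : Prop :=
  forall (i : triv_index E) (k : 'I_(rank E)),
    smooth_in (triv_dom i) (fun x => coord (frame i x) k (a x)).

(* The anchor [rho : A -> TM] is given by the action [anchor v f] of the
   tangent vector [rho v] on functions.  The bracket is a function on arbitrary
   sections, meaningful only on smooth ones. *)
Record skew_algebroid (R : realType) (n : nat) (M : smooth_manifold R n)
    (A : vector_bundle M) := SkewAlgebroid {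
  anchor : forall x : M, A x -> (M -> R) -> R;
  bracket : section A -> section A -> section A;
  anchor_tangent : forall x (v : A x), tangent_at x (anchor v);
  anchor_linear : forall x (c : R) (u v : A x) (f : M -> R), smooth_fun f ->
    anchor (c *: u + v) f = c * anchor u f + anchor v f;
  anchor_smooth : forall i (k : 'I_(rank A)) (f : M -> R), smooth_fun f ->
    smooth_in (triv_dom i) (fun x => anchor (frame i x)`_k f);
  bracket_smooth : forall a b, smooth_section a -> smooth_section b ->
    smooth_section (bracket a b);
  bracket_skew : forall a b, smooth_section a -> smooth_section b ->
    forall x, bracket a b x = - bracket b a x;
  bracket_linear : forall (c : R) a b d,
    smooth_section a -> smooth_section b -> smooth_section d ->
    forall x, bracket a (fun y => c *: b y + d y) x
              = c *: bracket a b x + bracket a d x;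
  bracket_leibniz : forall (f : M -> R) a b,
    smooth_fun f -> smooth_section a -> smooth_section b ->
    forall x, bracket a (fun y => f y *: b y) x
              = f x *: bracket a b x + anchor (a x) f *: b x }.

Arguments bracket {R n M A} _ _ _ _.

(* A bundle metric is given as the map [flat_g : A -> A^*]. *)
Record pseudo_riemannian (R : realType) (n : nat) (M : smooth_manifold R n)
    (A : vector_bundle M) (g : forall x : M, 'Hom(A x, dual_bundle A x)) : Prop :=
    PseudoRiemannian {
  metric_sym : forall x (u v : A x), g x u v = g x v u;
  metric_nondegenerate : forall x, lker (g x) = 0%VS;
  metric_smooth : forall i (k l : 'I_(rank A)),
    smooth_in (triv_dom i) (fun x => g x (frame i x)`_k (frame i x)`_l) }.

Section AlternatingFields.
Context (R : realType) (n : nat) (M : smooth_manifold R n).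

(* An element of the exterior algebra of the dual of [E x] is encoded by its
   values on finite sequences of vectors, the degree k part being the values on
   sequences of length k.  Forms on A are thus [altfield A] and, as A is the
   dual of A^*, multivector fields are [altfield (dual_bundle A)]. *)
Definition altfield (E : vector_bundle M) : Type := forall x : M, seq (E x) -> R.

Record smooth_alternating (E : vector_bundle M) (P : altfield E) : Prop :=
    SmoothAlternating {
  alt_linear : forall x (s1 s2 : seq (E x)) (c : R) (u v : E x),
    P x (s1 ++ (c *: u + v) :: s2)
    = c * P x (s1 ++ u :: s2) + P x (s1 ++ v :: s2);
  alt_alternating : forall x (s1 s2 s3 : seq (E x)) (u : E x),
    P x (s1 ++ u :: s2 ++ u :: s3) = 0;
  alt_smooth : forall i (ks : seq 'I_(rank E)),
    smooth_in (triv_dom i)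
      (fun x => P x [seq (frame i x)`_(k : 'I_(rank E)) | k <- ks]) }.

Definition homogeneous (E : vector_bundle M) (k : nat) (P : altfield E) : Prop :=
  smooth_alternating P /\ forall x (s : seq (E x)), size s <> k -> P x s = 0.

(* Number of pairs [i < j] with [m_i = false] and [m_j = true]. *)
Fixpoint inversions (m : bitseq) : nat :=
  if m is b :: m' then ((~~ b) * count id m' + inversions m')%N else 0%N.

(* Sum over shuffles, without factorials. *)
Definition wedge (E : vector_bundle M) (P Q : altfield E) : altfield E :=
  fun x s => \sum_(m : (size s).-tuple bool)
    (-1) ^+ inversions m * P x (mask m s) * Q x (mask (map negb m) s).

Definition alt_zero (E : vector_bundle M) : altfield E := fun _ _ => 0.

Definition alt_add (E : vector_bundle M) (c : R) (P Q : altfield E) :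
  altfield E := fun x s => c * P x s + Q x s.

End AlternatingFields.
Arguments wedge {R n M E} _ _ _ _.
Arguments alt_zero {R n M} E _ _.
Arguments alt_add {R n M E} _ _ _ _ _.

Section Calculus.
Context (R : realType) (n : nat) (M : smooth_manifold R n).
Context (A : vector_bundle M).

Definition vector_alt (a : section A) : altfield (dual_bundle A) :=
  fun x s => if s is [:: al] then al (a x) else 0.

Definition covector_alt (al : section (dual_bundle A)) : altfield A :=
  fun x s => if s is [:: v] then al x v else 0.

(* Pairing of degree k multivector fields and k-forms, computed in a basis; it
   is normalised by <P, al_1 /\ ... /\ al_k> = P(al_1, ..., al_k). *)
Definition pairing (k : nat) (P : altfield (dual_bundle A)) (eta : altfield A)
    (x : M) : R :=
  let e := vbasis {: A x} in
  (k`!%:R)^-1 * \sum_(t : k.-tuple 'I_(\dim {: A x}))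
    P x [seq (linfun (coord e i : A x -> R^o) : dual_bundle A x) | i <- t]
    * eta x [seq e`_(i : 'I_(\dim {: A x})) | i <- t].

End Calculus.
Arguments vector_alt {R n M A} _ _ _.
Arguments covector_alt {R n M A} _ _ _.

Section LieDerivative.
Context (R : realType) (n : nat) (M : smooth_manifold R n).
Context (A : vector_bundle M) (L : skew_algebroid A).

Definition is_lie_form (a : section A) (eta eta' : altfield A) : Prop :=
  smooth_alternating eta' /\
  forall ss : seq (section A),
    (forall i, (i < size ss)%N -> smooth_section (nth a ss i)) ->
    forall x, eta' x [seq s x | s <- ss]
      = anchor L (a x) (fun y => eta y [seq s y | s <- ss])
        - \sum_(i < size ss)
            eta x [seq s x | s <- set_nth a ss i (bracket L a (nth a ss i))].

(* Here and below, [xget] selects the unique element with the given property;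
   its default value is irrelevant. *)
Definition lie_form (a : section A) (eta : altfield A) : altfield A :=
  xget (alt_zero A : {classic altfield A}) [set eta' | is_lie_form a eta eta'].

Arguments lie_form : clear implicits.

Definition lie_form1 (a : section A) (al : section (dual_bundle A)) :
    section (dual_bundle A) :=
  fun x => linfun (fun v : A x => lie_form a (covector_alt al) x [:: v] : R^o).

(* [Q] is the Lie derivative along [a] of the degree k multivector field [P]. *)
Definition is_lie_multivector (k : nat) (a : section A)
    (P Q : altfield (dual_bundle A)) : Prop :=
  homogeneous k Q /\
  forall eta : altfield A, homogeneous k eta ->
    forall x, pairing k Q eta x
      = anchor L (a x) (pairing k P eta) - pairing k P (lie_form a eta) x.

(* [SN] is meaningful only on homogeneous multivector fields. *)
Record schouten_nijenhuis
    (SN : altfield (dual_bundle A) -> altfield (dual_bundle A) ->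
          altfield (dual_bundle A)) : Prop := SchoutenNijenhuis {
  SN_degree : forall k l P Q, homogeneous k P -> homogeneous l Q ->
    homogeneous (k + l).-1 (SN P Q);
  SN_linearl : forall k l (c : R) P P' Q,
    homogeneous k P -> homogeneous k P' -> homogeneous l Q ->
    SN (alt_add c P P') Q = alt_add c (SN P Q) (SN P' Q);
  SN_linearr : forall k l (c : R) P Q Q',
    homogeneous k P -> homogeneous l Q -> homogeneous l Q' ->
    SN P (alt_add c Q Q') = alt_add c (SN P Q) (SN P Q');
  SN_fun : forall P Q, homogeneous 0 P -> homogeneous 0 Q ->
    SN P Q = alt_zero (dual_bundle A);
  SN_lie : forall k a P, smooth_section a -> homogeneous k P ->
    is_lie_multivector k a P (SN (vector_alt a) P);
  SN_sym : forall k l P Q, homogeneous k P -> homogeneous l Q ->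
    forall x s, SN P Q x s = (-1) ^+ (k * l) * SN Q P x s;
  SN_leibniz : forall k l m P Q S,
    homogeneous k P -> homogeneous l Q -> homogeneous m S ->
    forall x s, SN P (wedge Q S) x s
      = wedge (SN P Q) S x s + (-1) ^+ (k.+1 * l) * wedge Q (SN P S) x s }.

Definition jacobi_structure
    (SN : altfield (dual_bundle A) -> altfield (dual_bundle A) ->
          altfield (dual_bundle A))
    (Pi : altfield (dual_bundle A)) (xi : section A) : Prop :=
  (forall x s, SN Pi Pi x s = 2 * wedge (vector_alt xi) Pi x s) /\
  is_lie_multivector 2 xi Pi (alt_zero (dual_bundle A)).

End LieDerivative.
Arguments lie_form {R n M A} _ _ _ _ _.
Arguments lie_form1 {R n M A} _ _ _ _.

(* [nabla] is the Levi-Civita connection of the bundle [E] with anchor [rho],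
   bracket [br] and metric [h]. *)
Record levi_civita (R : realType) (n : nat) (M : smooth_manifold R n)
    (E : vector_bundle M) (rho : forall x : M, E x -> (M -> R) -> R)
    (br : section E -> section E -> section E) (h : forall x : M, E x -> E x -> R)
    (nabla : section E -> section E -> section E) : Prop := LeviCivita {
  conn_smooth : forall a b, smooth_section a -> smooth_section b ->
    smooth_section (nabla a b);
  conn_linearl : forall (c : R) a a' b,
    smooth_section a -> smooth_section a' -> smooth_section b ->
    forall x, nabla (fun y => c *: a y + a' y) b x
              = c *: nabla a b x + nabla a' b x;
  conn_linearr : forall (c : R) a b b',
    smooth_section a -> smooth_section b -> smooth_section b' ->
    forall x, nabla a (fun y => c *: b y + b' y) x
              = c *: nabla a b x + nabla a b' x;
  conn_tensor : forall (f : M -> R) a b,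
    smooth_fun f -> smooth_section a -> smooth_section b ->
    forall x, nabla (fun y => f y *: a y) b x = f x *: nabla a b x;
  conn_leibniz : forall (f : M -> R) a b,
    smooth_fun f -> smooth_section a -> smooth_section b ->
    forall x, nabla a (fun y => f y *: b y) x
              = f x *: nabla a b x + rho x (a x) f *: b x;
  conn_torsion : forall a b, smooth_section a -> smooth_section b ->
    forall x, nabla a b x - nabla b a x = br a b x;
  conn_metric : forall a b c,
    smooth_section a -> smooth_section b -> smooth_section c ->
    forall x, rho x (a x) (fun y => h y (b y) (c y))
              = h x (nabla a b x) (c x) + h x (b x) (nabla a c x) }.

Section Compatibility.
Context (R : realType) (n : nat) (M : smooth_manifold R n).
Context (A : vector_bundle M) (L : skew_algebroid A).
Context (g : forall x : M, 'Hom(A x, dual_bundle A x)).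
Context (Pi : altfield (dual_bundle A)) (xi : section A).
Arguments Pi : clear implicits.

Definition sharp_metric (x : M) : 'Hom(dual_bundle A x, A x) := (g x)^-1%VF.

Definition cometric (x : M) (al be : dual_bundle A x) : R :=
  g x (sharp_metric x al) (sharp_metric x be).

Definition sharp (x : M) : 'Hom(dual_bundle A x, A x) :=
  xget 0 [set S : 'Hom(dual_bundle A x, A x) |
          forall al be : dual_bundle A x, be (S al) = Pi x [:: al; be]].

Definition Jend (x : M) : 'End(A x) :=
  xget 0 [set J : 'End(A x) | forall al be : dual_bundle A x,
          g x (J (sharp_metric x al)) (sharp_metric x be) = Pi x [:: al; be]].

Definition Jdual (x : M) : 'End(dual_bundle A x) :=
  xget 0 [set J : 'End(dual_bundle A x) | forall al be : dual_bundle A x,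
          cometric (J al) be = Pi x [:: al; be]].

Definition lambda : section (dual_bundle A) :=
  fun x => g x (xi x) (xi x) *: g x (xi x) - g x (Jend x (xi x)).

Definition d_anchor (f : M -> R) : section (dual_bundle A) :=
  fun x => linfun (fun v : A x => anchor L v f : R^o).

Definition bracket_Pi (al be : section (dual_bundle A)) :
    section (dual_bundle A) :=
  fun x => lie_form1 L (fun y => sharp y (al y)) be x
           - lie_form1 L (fun y => sharp y (be y)) al x
           - d_anchor (fun y => Pi y [:: al y; be y]) x.

Definition sharp_xi (x : M) (al : dual_bundle A x) : A x :=
  sharp x al + al (xi x) *: xi x.

Definition anchor_xi (x : M) (al : dual_bundle A x) : (M -> R) -> R :=
  anchor L (sharp_xi al).

Definition bracket_xi (al be : section (dual_bundle A)) :
    section (dual_bundle A) :=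
  fun x => bracket_Pi al be x
           + al x (xi x) *: (lie_form1 L xi be x - be x)
           - be x (xi x) *: (lie_form1 L xi al x - al x)
           - Pi x [:: al x; be x] *: lambda x.

Definition compatible
    (D : section (dual_bundle A) -> section (dual_bundle A) ->
         section (dual_bundle A)) : Prop :=
  forall al be ga : section (dual_bundle A),
    smooth_section al -> smooth_section be -> smooth_section ga ->
    forall x,
      anchor_xi (al x) (fun y => Pi y [:: be y; ga y])
      - Pi x [:: D al be x; ga x] - Pi x [:: be x; D al ga x]
      = 2^-1 * (ga x (xi x) * Pi x [:: al x; be x]
                - be x (xi x) * Pi x [:: al x; ga x]
                - Jdual x (ga x) (xi x) * cometric (al x) (be x)
                + Jdual x (be x) (xi x) * cometric (al x) (ga x)).

End Compatibility.

(* Main.v *)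
From HB Require Import structures.
Require Import Defs.
From mathcomp Require Import all_boot all_order all_algebra.
From mathcomp Require Import all_classical all_reals all_analysis.
From mathcomp Require Import ring lra.
Set Implicit Arguments.
Unset Strict Implicit.
Unset Printing Implicit Defensive.
Import Order.TTheory GRing.Theory Num.Theory.
Import numFieldNormedType.Exports.
Local Open Scope classical_set_scope.
Local Open Scope ring_scope.

(** The theorem follows from one identity for a compatible triple with
    $\mathcal{L}_\xi\Pi=0$,
    $$[\Pi,\Pi]=\xi\wedge\Pi+\sharp_\Pi(\lambda)\wedge\Pi,$$
    since then $2\xi\wedge\Pi-[\Pi,\Pi]=(\xi-\sharp_\Pi(\lambda))\wedge\Pi$.

    To obtain it, sum the compatibility condition over cyclic permutations of
    $(\alpha,\beta,\gamma)$. The right-hand side becomes $\xi\wedge\Pi$, as its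
    terms with the cometric cancel in pairs. On the left the Levi-Civita
    connection disappears, because only its torsion contributes
    ([levi_civita_cyclic]); expanding the bracket $[\cdot,\cdot]^g_{\Pi,\xi}$
    and using $\mathcal{L}_\xi\Pi=0$ leaves
    $$\sum_{cyc}\big(\rho(\sharp_\Pi\alpha)\cdot\Pi(\beta,\gamma)-\Pi([\alpha,\beta]_\Pi,\gamma)\big)
      +2\xi\wedge\Pi+\sharp_\Pi(\lambda)\wedge\Pi,$$
    and the remaining sum is $-[\Pi,\Pi](\alpha,\beta,\gamma)$ ([cyclic_bracket_Pi]).

    This last step needs an explicit expression for the Schouten bracket of two
    bivector fields, whereas the bracket is characterised only by its algebraic
    properties. For a decomposable second argument, the Leibniz rule reduces it
    to Lie derivatives ([schouten_decomposable]). In general both sides are local,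
    and near a point a bivector field is a finite sum of decomposable ones
    ([SN_schouten_formula]).

    The hypotheses speak of global smooth sections only. Localisation, and the
    passage from sections to vectors in a fibre, rest on smooth bump functions
    ([bump_fun]), which are built from $e^{-1/t}$; their smoothness is obtained
    from a coinductive closure principle ([smooth_on_coind]). The Lie derivatives
    of forms, which are selected by a choice operator, are shown to exist
    ([lie_covector_exists], [lie_form_cowedge]). *)

(** * Functions that are flat at the origin *)

Section Flat.
Context {R : realType}.
Implicit Types (p : {poly R}) (t : R).

(** The functions $e^{-1/t}p(1/t)$ on $t>0$, extended by $0$: letting $p$ range
    over all polynomials makes the family closed under differentiation. *)
Definition flat p t : R := if 0 < t then p.[t^-1] * expR (- t^-1) else 0.

(** With $x=1/t$, the exponential series gives $x^{i+1}/(i+1)! \le e^x$, hence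
    $x^i e^{-x} \le (i+1)!\,t$ for each monomial. Applied to $Xp$, this bound
    gives the vanishing of the derivative of [flat p] at the origin. *)
Lemma flat_le_linear p : exists C : R, forall t, `|flat p t| <= C * `|t|.
Proof.
exists (\sum_(i < size p) `|p`_i| * (i.+1)`!%:R) => t; rewrite /flat.
case: ltrP => [t0|_]; last first.
  by rewrite normr0 mulr_ge0// sumr_ge0// => i _; rewrite mulr_ge0.
rewrite horner_coef mulr_suml mulr_suml (gtr0_norm t0).
apply: le_trans (ler_norm_sum _ _ _) _; apply: ler_sum => i _.
rewrite !normrM -!mulrA ler_wpM2l//.
have x0 : 0 < t^-1 by rewrite invr_gt0.
rewrite ger0_norm ?exprn_ge0 ?(ltW x0)// ger0_norm ?expR_ge0//.
rewrite expRN ler_pdivrMr ?expR_gt0//.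
have : t^-1 ^+ i.+1 / (i.+1)`!%:R <= expR t^-1.
  by apply: le_trans (expR_ge1Dxn i (ltW x0)); rewrite lerDr ler01.
set F := _ `!%:R; have F0 : 0 < F by rewrite ltr0n fact_gt0.
rewrite ler_pdivrMr// exprS mulrC ler_pdivrMr// => le1.
by rewrite [leRHS](_ : _ = expR t^-1 * F * t) //; ring.
Qed.

Lemma is_derive_flat p t :
  is_derive t (1:R) (flat p) (flat ('X^2 * (p - p^`())) t).
Proof.
have [t0|t0|->] := ltrgtP t 0.
- apply: (@near_eq_is_derive _ _ _ (cst 0)).
    near=> y; rewrite /flat ltNge ltW//.
    by near: y; exact: lt_nbhsl.
  rewrite /flat ltNge (ltW t0)/=; exact: is_derive_cst.
- apply: (@near_eq_is_derive _ _ _ (fun t => p.[t^-1] * expR (- t^-1))).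
    near=> y; rewrite /flat (_ : 0 < y)//.
    by near: y; exact: lt_nbhsr.
  have tn0 : t != 0 by rewrite gt_eqF.
  rewrite /flat t0.
  have dV : is_derive t (1:R) (fun t => t^-1) (- t ^- 2).
    apply: DeriveDef; first exact: derivableV.
    by rewrite deriveV//= derive_id /GRing.scale /= mulr1.
  have dp : is_derive t (1:R) (fun t => p.[t^-1]) ((p^`()).[t^-1] * - t ^- 2).
    exact: (is_derive1_comp (is_derive_poly p t^-1) dV).
  have de : is_derive t (1:R) (fun t => expR (- t^-1))
      (expR (- t^-1) * - - t ^- 2).
    exact: (@is_derive1_comp _ expR (fun t => - t^-1) _ _ _
      (is_derive_expR _) (is_deriveN dV)).
  apply: (is_derive_eq (is_deriveM dp de)).
  rewrite hornerM hornerXn hornerD hornerN exprVn.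
  by rewrite /GRing.scale /=; ring.
- rewrite {2}/flat ltxx.
  have [C hC] := flat_le_linear ('X * p).
  have flatX h : h^-1 * flat p h = flat ('X * p) h.
    rewrite /flat; case: ifP => _; last by rewrite mulr0.
    by rewrite hornerM hornerX mulrA.
  (* The difference quotient of [flat p] at 0 is [flat ('X * p)] itself. *)
  suff H : (fun h : R => h^-1 *: (flat p (h *: 1 + 0) - flat p 0)) @ 0^' --> (0:R).
    by apply: DeriveDef; [apply/cvg_ex; exists 0 | exact: cvg_lim].
  rewrite (_ : (fun h => _) = flat ('X * p)); last first.
    apply/funext => h; rewrite addr0 {2}/flat ltxx subr0 /GRing.scale /= mulr1.
    exact: flatX.
  apply/cvgr0Pnorm_lt => e e0.
  near=> h; apply: le_lt_trans (hC h) _.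
  have CC : 0 < `|C| + 1 by rewrite ltr_pwDr.
  apply: (@le_lt_trans _ _ ((`|C| + 1) * `|h|)).
    by rewrite ler_wpM2r// (le_trans (ler_norm _))// lerDl.
  rewrite mulrC -ltr_pdivlMr//.
  near: h; apply: dnbhs0_lt; exact: divr_gt0.
Unshelve. all: by end_near. Qed.

Lemma differentiable_flat p t : differentiable (flat p : R -> R^o) t.
Proof. by apply/derivable1_diffP; case: (is_derive_flat p t). Qed.

End Flat.

(** * A closure principle for smooth functions *)

Section SmoothCalculus.
Context {R : realType} {V : normedModType R} (U : set V).
Hypothesis oU : open U.

(** Smoothness is coinductive: a class of differentiable functions whose
    directional derivatives agree on [U] with members of the class consists of
    smooth functions, because iterated derivatives never leave it. This replaces
    Leibniz and chain rules for higher derivatives by first-order rules. *)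
Lemma smooth_on_coind {W : normedModType R} (C : (V -> W) -> Prop) :
  (forall f, C f -> (forall x, U x -> differentiable f x) /\
    forall v, exists2 g, C g & forall x, U x -> 'D_v f x = g x) ->
  forall f, C f -> smooth_on U f.
Proof.
move=> step f Cf vs x Ux.
have nearU y (P : V -> Prop) : U y -> (forall z, U z -> P z) ->
    \forall z \near y, P z.
  by move=> Uy UP; apply: filterS UP _; exact: open_nbhs_nbhs.
suff [g Cg fg] : exists2 g, C g & forall y, U y ->
    foldr (fun v h => 'D_v h) f vs y = g y.
  apply: (@near_eq_differentiable _ _ _ g); last exact: (step g Cg).1.
  by apply: nearU => // y Uy; rewrite fg.
elim: vs => [|v vs [g Cg fg]] /=; first by exists f.
have [g' Cg' gg'] := (step g Cg).2 v; exists g' => // y Uy.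
by rewrite -gg'//; apply: near_eq_derive; exact: nearU.
Qed.

Lemma smooth_onP {W : normedModType R} (f : V -> W) :
  smooth_on U f -> (forall x, U x -> differentiable f x) /\
    forall v, smooth_on U ('D_v f).
Proof.
move=> sf; split=> [x Ux|v vs x Ux]; first exact: (sf [::] x Ux).
by have := sf (rcons vs v) x Ux; rewrite foldr_rcons.
Qed.

Lemma smooth_on_cst {W : normedModType R} (c : W) : smooth_on U (fun=> c).
Proof.
apply: (@smooth_on_coind _ (fun f => exists c : W, f = cst c)); last by exists c.
move=> _ [d ->]; split=> [x _|v]; first exact: differentiable_cst.
by exists (cst 0); [exists 0 | move=> x _; exact: derive_cst].
Qed.

(** The class to which [smooth_on_coind] is applied: it contains, along with each
    function, an expression for its directional derivatives built from the
    same constructors. *)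
Inductive smooth_generated : (V -> R^o) -> Prop :=
| SmoothGen f : smooth_on U f -> smooth_generated f
| SmoothGenD f h :
    smooth_generated f -> smooth_generated h -> smooth_generated (f + h)
| SmoothGenM f h : smooth_generated f -> smooth_generated h ->
    smooth_generated (fun x => (f x : R) * h x)
| SmoothGenV f : (forall x, U x -> f x != 0) ->
    smooth_generated f -> smooth_generated (fun x => (f x : R)^-1)
| SmoothGenFlat p f : smooth_generated f ->
    smooth_generated (fun x => flat p (f x)).

Lemma smooth_generated_on f : smooth_generated f -> smooth_on U f.
Proof.
move: f; apply: smooth_on_coind => f; elim=> {f}.
- move=> f /smooth_onP[df Df]; split=> // v; exists ('D_v f) => //.
  exact: SmoothGen.
- move=> f h gf [df Df] gh [dh Dh]; split=> [x Ux|v].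
    by apply: differentiableD; [exact: df | exact: dh].
  have [[f' gf' ff'] [h' gh' hh']] := (Df v, Dh v).
  exists (f' + h'); first exact: SmoothGenD.
  move=> x Ux; rewrite deriveD; last 2 first.
  + exact/diff_derivable/df.
  + exact/diff_derivable/dh.
  by rewrite ff'// hh'.
- move=> f h gf [df Df] gh [dh Dh]; split=> [x Ux|v].
    by apply: (@differentiableM _ _ (f : V -> R)); [exact: df | exact: dh].
  have [[f' gf' ff'] [h' gh' hh']] := (Df v, Dh v).
  exists ((fun x => (f x : R) * h' x) + (fun x => (h x : R) * f' x)).
    by apply: SmoothGenD; exact: SmoothGenM.
  move=> x Ux; rewrite (@deriveM _ _ (f : V -> R)); last 2 first.
  + exact/diff_derivable/df.
  + exact/diff_derivable/dh.
  by rewrite ff'// hh'.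
- move=> f f0 gf [df Df]; split=> [x Ux|v].
    by apply: (@differentiableV _ _ (f : V -> R)); [exact: df | exact: f0].
  have [f' gf' ff'] := Df v.
  pose f1 := (fun x => (f x : R)^-1) : V -> R^o.
  exists (fun x => ((-1 : R) * ((f1 x : R) * f1 x)) * f' x).
    apply: (@SmoothGenM (fun x => (-1 : R) * ((f1 x : R) * f1 x))) => //.
    apply: (@SmoothGenM (fun x => -1)) => //.
      by apply: SmoothGen; exact: smooth_on_cst.
    by apply: SmoothGenM; exact: SmoothGenV.
  move=> x Ux; rewrite (@deriveV _ _ (f : V -> R)).
  + by rewrite ff'// /GRing.scale /= mulN1r -expr2 exprVn.
  + exact: f0.
  + exact/diff_derivable/df.
- move=> p f gf [df Df]; split=> [x Ux|v].
    apply: (@differentiable_comp _ _ _ _ f (flat p : R -> R^o)); first exact: df.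
    exact: differentiable_flat.
  have [f' gf' ff'] := Df v.
  exists (fun x => flat ('X^2 * (p - p^`())) (f x) * (f' x : R)).
    by apply: SmoothGenM => //; exact: SmoothGenFlat.
  move=> x Ux; have dfx := df _ Ux.
  have dfl := differentiable_flat p (f x).
  rewrite deriveE; last exact: (@differentiable_comp _ _ _ _ f (flat p : R -> R^o)).
  rewrite (@diff_comp _ _ _ _ f (flat p : R -> R^o))//=.
  rewrite -(deriveE v dfx) ff'//.
  rewrite deriv1E; last exact/derivable1_diffP.
  have [_ dE] := is_derive_flat p (f x).
  by rewrite derive1E dE; exact: mulrC.
Qed.

End SmoothCalculus.

(** * Smooth functions on a manifold and bump functions *)

Lemma smooth_on_coord {R : realType} {V : normedModType R} (U : set V) (n : nat)
    (F : V -> 'rV[R]_n) (k : 'I_n) :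
  open U -> smooth_on U F -> smooth_on U (fun x => F x 0 k : R^o).
Proof.
move=> oU sF; apply: (@smooth_on_coind _ _ _ oU R^o
  (fun f => exists2 G : V -> 'rV[R]_n, smooth_on U G & f = fun x => G x 0 k)).
  move=> _ [G /smooth_onP[dG DG] ->]; split=> [x Ux|v].
    apply: (@differentiable_comp _ _ _ _ G (fun N : 'rV[R]_n => N 0 k : R^o)).
      exact: dG.
    exact: differentiable_coord.
  exists (fun x => 'D_v G x 0 k); first by exists ('D_v G).
  by move=> x Ux; rewrite derive_mx ?mxE//; exact/diff_derivable/dG.
by exists F.
Qed.

Section SmoothFunctions.
Context {R : realType} {n : nat} {M : smooth_manifold R n}.
Implicit Types (U : set M) (f h : M -> R).

Lemma smooth_in_local U f :
  (forall x, U x -> exists2 W : set M, W x & smooth_in W f) -> smooth_in U f.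
Proof.
move=> loc i vs _ [x [ix Ux] <-]; have [W Wx sf] := loc x Ux.
by apply: sf; exists x.
Qed.

Lemma smooth_in_sub U W f : U `<=` W -> smooth_in W f -> smooth_in U f.
Proof. by move=> UW sf; apply: smooth_in_local => x /UW; exists W. Qed.

Lemma smooth_fun_in U f : smooth_fun f -> smooth_in U f.
Proof. exact: smooth_in_sub. Qed.

Lemma smooth_in_cst U c : smooth_in U (fun=> c).
Proof.
suff : smooth_fun (M := M) (fun=> c) by exact: smooth_fun_in.
by move=> i; apply: smooth_on_cst; apply: chart_img_openI; exact: openT.
Qed.

Lemma smooth_inD U f h : open U ->
  smooth_in U f -> smooth_in U h -> smooth_in U (fun x => f x + h x).
Proof.
move=> oU sf sh i; have oi := chart_img_openI (i := i) oU.
exact (smooth_generated_on oi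
  (SmoothGenD (SmoothGen (sf i)) (SmoothGen (sh i)))).
Qed.

Lemma smooth_inM U f h : open U ->
  smooth_in U f -> smooth_in U h -> smooth_in U (fun x => f x * h x).
Proof.
move=> oU sf sh i; have oi := chart_img_openI (i := i) oU.
exact (smooth_generated_on oi
  (SmoothGenM (SmoothGen (sf i)) (SmoothGen (sh i)))).
Qed.

Lemma smooth_inV U f : open U -> (forall x, U x -> f x != 0) ->
  smooth_in U f -> smooth_in U (fun x => (f x)^-1).
Proof.
move=> oU f0 sf i; have oi := chart_img_openI (i := i) oU.
refine (smooth_generated_on oi (SmoothGenV _ (SmoothGen (sf i)))).
move=> _ [x [ix Ux] <-].
by rewrite /= chartK// f0.
Qed.

Lemma smooth_in_sum U (I : Type) (r : seq I) (P : pred I) (F : I -> M -> R) :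
  open U -> (forall i, P i -> smooth_in U (F i)) ->
  smooth_in U (fun x => \sum_(i <- r | P i) F i x).
Proof.
move=> oU sF; elim: r => [|i r IH].
  by refine (eq_smooth_in oU _ (smooth_in_cst 0)) => x _; rewrite big_nil.
case Pi: (P i); last first.
  by refine (eq_smooth_in oU _ IH) => x _; rewrite big_cons Pi.
refine (eq_smooth_in oU _ (smooth_inD oU (sF i Pi) IH)) => x _.
by rewrite big_cons Pi.
Qed.

Lemma smooth_funD f h : smooth_fun f -> smooth_fun h ->
  smooth_fun (fun x => f x + h x).
Proof. exact: smooth_inD openT. Qed.

Lemma smooth_funM f h : smooth_fun f -> smooth_fun h ->
  smooth_fun (fun x => f x * h x).
Proof. exact: smooth_inM openT. Qed.

Lemma smooth_funN f : smooth_fun f -> smooth_fun (fun x => - f x).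
Proof.
move=> sf; refine (eq_smooth_in openT _ (smooth_funM (smooth_in_cst (-1)) sf)).
by move=> x _; rewrite mulN1r.
Qed.

(** In a chart around [x], the function is [flat 1] of $e^2 - |y-c|^2$, which is
    positive exactly on a Euclidean ball. Outside the chart it is extended by
    zero; this is smooth because the ball lies in a compact subset of the chart
    image, and the corresponding subset of [M] is closed as [M] is Hausdorff. *)
Lemma bump_fun (x : M) (V : set M) : open V -> V x ->
  exists f, [/\ smooth_fun f, f x = 1 &
    exists K, [/\ closed K, K `<=` V & forall y, ~ K y -> f y = 0]].
Proof.
move=> oV Vx; have [i ix] := chart_cover x.
pose W := chart i @` (chart_dom i `&` V).
have oW : open W by exact: chart_img_openI.
have Wc : W (chart i x) by exists x.
have [e /= e0 eW] : exists2 e : R, 0 < e & closed_ball (chart i x) e `<=` W.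
  have /nbhs_ballP[e /= e0 eW] : nbhs (chart i x) W by exact: open_nbhs_nbhs.
  exists (e / 2); first exact: divr_gt0.
  apply: subset_trans eW; apply: closed_ball_subset; first exact: divr_gt0.
  by rewrite ltr_pdivrMr// mulr_natr mulr2n ltrDr.
set c := chart i x in Wc eW *.
pose B := closed_ball c e.
have cB : compact B.
  apply: bounded_closed_compact; last exact: closed_ball_closed.
  exists (`|c| + e); split; first exact: num_real.
  move=> r cr y; rewrite /B closed_ballE// /closed_ball_ /= => ye.
  rewrite (le_trans _ (ltW cr))// -[y](subKr c) (le_trans (ler_normB _ _))//.
  by rewrite lerD2l.
pose K := chart_inv i @` B.
(* [K] is compact as a continuous image, and lies both in the chart and in [V]. *)
have KVi : K `<=` chart_dom i `&` V.
  by move=> _ [y /eW[z [iz Vz] <-] <-]; rewrite chartK.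
have clK : closed K.
  apply: compact_closed; first exact: manifold_hausdorff.
  apply: continuous_compact => //; apply: continuous_in_subspaceT => y.
  rewrite inE => /eW[z [iz Vz] <-]; apply: chart_inv_continuous.
  by exists z.
pose d (y : 'rV[R]_n) := e ^+ 2 - \sum_k (y 0 k - c 0 k) ^+ 2.
pose N := flat 1 (e ^+ 2).
have N0 : N != 0.
  by rewrite /N /flat exprn_gt0// hornerC mul1r gt_eqF// expR_gt0.
pose f y := if `[< chart_dom i y >] then N^-1 * flat 1 (d (chart i y)) else 0.
have fK y : ~ K y -> f y = 0.
  move=> nKy; rewrite /f; case: asboolP => // iy.
  rewrite /flat; case: ifP => [dy|_]; last by rewrite mulr0.
  case: nKy; exists (chart i y); last by rewrite chartK.
  rewrite /B closed_ballE// /closed_ball_ /=.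
  rewrite [leLHS]/Num.Def.normr /= mx_normrE; apply: bigmax_le => [|[a k] _] /=.
    exact: ltW.
  rewrite !mxE ord1 -(@ler_pXn2r _ 2)// ?nnegrE ?normr_ge0 ?(ltW e0)//.
  rewrite real_normK ?num_real// -sqrrN opprB.
  move: dy; rewrite subr_gt0 => /ltW; apply: le_trans.
  by rewrite (bigD1 k)//= lerDl sumr_ge0// => l _; rewrite sqr_ge0.
exists f; split; last by exists K; split=> // y /KVi[].
  apply: (@smooth_in_local setT) => y _.
  have [iy|niy] := pselect (chart_dom i y); last first.
    exists (~` K); first by move=> /KVi[].
    refine (eq_smooth_in _ _ (smooth_in_cst 0)).
      exact: closed_openC.
    by move=> z /fK.
  exists (chart_dom i) => // j.
  have oj : open (chart j @` (chart_dom j `&` chart_dom i)).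
    by apply: chart_img_openI; exact: chart_dom_open.
  (* In another chart the bump is [flat 1] of a polynomial in the components of
     the transition map. *)
  pose F (u : 'rV[R]_n) (k : 'I_n) := chart i (chart_inv j u) 0 k.
  apply: (@eq_smooth_on _ _ _ _ (fun u =>
    N^-1 * flat 1 (e ^+ 2 + \sum_k ((F u k - c 0 k) * (c 0 k - F u k))))) => //.
    move=> _ [z [jz iz] <-] /=; rewrite /f chartK// asboolT// /d -sumrN.
    congr (_ * flat _ (_ + _)); apply: eq_bigr => k _.
    by rewrite /F chartK// -(opprB _ (c 0 k)) mulrN.
  have cst_gen a : smooth_generated (chart j @` (chart_dom j `&` chart_dom i))
      (fun=> a) by apply: SmoothGen; exact: smooth_on_cst.
  apply: (smooth_generated_on oj); apply: SmoothGenM => //.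
  apply: SmoothGenFlat; apply: (@SmoothGenD _ _ _ (fun=> e ^+ 2)) => //.
  elim: (index_enum _) => [|k r IH].
    by rewrite (_ : (fun=> _) = fun=> 0)//; apply/funext => u; rewrite big_nil.
  under eq_fun do rewrite big_cons; apply: SmoothGenD => //.
  have sF : smooth_generated (chart j @` (chart_dom j `&` chart_dom i)) (F^~ k).
    apply: SmoothGen; apply: (smooth_on_coord k oj).
    exact: (@chart_smooth _ _ M j i).
  apply: SmoothGenM; first by apply: (@SmoothGenD _ _ _ (F^~ k) (fun=> - c 0 k)).
  apply: (@SmoothGenD _ _ _ (fun=> c 0 k) (fun u => - F u k)) => //.
  rewrite (_ : (fun u => - F u k) = fun u => -1 * F u k); last first.
    by apply/funext => u; rewrite mulN1r.
  exact: (@SmoothGenM _ _ _ (fun=> -1)).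
rewrite /f asboolT// /d big1 ?subr0 ?mulVf// => k _.
by rewrite subrr expr0n.
Qed.

End SmoothFunctions.

(** * Global smooth sections *)

Section SmoothSections.
Context {R : realType} {n : nat} {M : smooth_manifold R n}.
Implicit Types (E : vector_bundle M) (f h : M -> R).

Lemma smooth_fun_continuous f : smooth_fun f -> continuous f.
Proof.
move=> sf x; have [i ix] := chart_cover x.
have cf : {for chart i x, continuous (f \o chart_inv i : _ -> R^o)}.
  apply: differentiable_continuous; apply: (sf i [::] (chart i x)).
  by exists x.
have cfc : f (chart_inv i (chart i y)) @[y --> x] --> f x.
  have -> : f x = f (chart_inv i (chart i x)) by rewrite chartK.
  exact: (continuous_comp (chart_continuous ix) cf).
apply: cvg_trans cfc; apply: near_eq_cvg.
have : \forall y \near x, chart_dom i y.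
  by apply: open_nbhs_nbhs; split=> //; exact: chart_dom_open.
by apply: filterS => y iy; rewrite chartK.
Qed.

Lemma smooth_fun_neq0_open f : smooth_fun f -> open [set x | f x != 0].
Proof.
move=> sf; apply: (@open_comp _ _ f [set y | y != 0]).
  by move=> x _; exact: smooth_fun_continuous.
exact: open_neq.
Qed.

Section Closure.
Context {E : vector_bundle M}.
Implicit Types a b : section E.

Lemma frame_expand (i : triv_index E) x (v : E x) : triv_dom i x ->
  v = \sum_k coord (frame i x) k v *: (frame i x)`_k.
Proof. by move=> ix; apply: coord_basis (memvf v); exact: frame_basis. Qed.

Lemma smooth_section0 : smooth_section (fun x => 0 : E x).
Proof.
move=> i k; refine (eq_smooth_in _ _ (smooth_in_cst 0)).
  exact: triv_dom_open.
by move=> x _; rewrite linear0.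
Qed.

Lemma smooth_sectionD a b : smooth_section a -> smooth_section b ->
  smooth_section (fun x => a x + b x).
Proof.
move=> sa sb i k; have oi := @triv_dom_open _ _ _ E i.
refine (eq_smooth_in oi _ (smooth_inD oi (sa i k) (sb i k))) => x _.
by rewrite linearD.
Qed.

Lemma smooth_sectionZ f a : smooth_fun f -> smooth_section a ->
  smooth_section (fun x => f x *: a x).
Proof.
move=> sf sa i k; have oi := @triv_dom_open _ _ _ E i.
refine (eq_smooth_in oi _ (smooth_inM oi (smooth_fun_in sf) (sa i k))) => x _.
by rewrite linearZ.
Qed.

Lemma smooth_section_sum (I : Type) (r : seq I) (F : I -> section E) :
  (forall i, smooth_section (F i)) ->
  smooth_section (fun x => \sum_(i <- r) F i x).
Proof.
move=> sF i k; have oi := @triv_dom_open _ _ _ E i.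
refine (eq_smooth_in oi _ (smooth_in_sum r (P := xpredT) oi
  (fun j _ => sF j i k))) => x _.
by rewrite linear_sum.
Qed.

Lemma smooth_cutoff_frame (i : triv_index E) (k : 'I_(rank E)) f (K : set M) :
  smooth_fun f -> closed K -> K `<=` triv_dom i -> (forall y, ~ K y -> f y = 0) ->
  smooth_section (fun x => f x *: (frame i x)`_k).
Proof.
move=> sf cK Ki fK j l; apply: smooth_in_local => x jx.
have [ix|nix] := pselect (triv_dom i x).
  exists (triv_dom i `&` triv_dom j) => //.
  have oW : open (@triv_dom _ _ _ E i `&` triv_dom j).
    by apply: openI; exact: triv_dom_open.
  refine (eq_smooth_in oW _ (smooth_inM oW (smooth_fun_in sf)
    (@frame_smooth _ _ _ E i j k l))) => y _.
  by rewrite linearZ.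
exists (~` K); first by move=> /Ki.
refine (eq_smooth_in _ _ (smooth_in_cst 0)); first exact: closed_openC.
by move=> y /fK ->; rewrite scale0r linear0.
Qed.

(** All hypotheses on brackets, connections and multivector fields quantify over
    global sections; this lemma turns their consequences into statements
    about vectors in a single fibre. *)
Lemma smooth_section_through x (v : E x) :
  exists2 a : section E, smooth_section a & a x = v.
Proof.
have [i ix] := @triv_cover _ _ _ E x.
have [f [sf fx [K [cK Ki fK]]]] := bump_fun (@triv_dom_open _ _ _ E i) ix.
exists (fun y => \sum_k coord (frame i x) k v *: (f y *: (frame i y)`_k)).
  apply: smooth_section_sum => k; apply: smooth_sectionZ.
    exact: smooth_in_cst.
  exact: smooth_cutoff_frame sf cK Ki fK.
by rewrite [RHS](frame_expand v ix); apply: eq_bigr => k _; rewrite fx scale1r.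
Qed.

End Closure.

Section Dual.
Context {A : vector_bundle M}.
Implicit Types (a : section A) (al : section (dual_bundle A)).

Lemma coord_coframe (i : triv_index A) x k (al : dual_bundle A x) :
  triv_dom i x -> coord (coframe i x) k al = al (frame i x)`_k.
Proof.
move=> ix; rewrite {1}(coframe_expand al ix).
by rewrite coord_sum_free ?(basis_free (coframe_basis ix)).
Qed.

Lemma smooth_covector_eval al a : smooth_section al -> smooth_section a ->
  smooth_fun (fun x => al x (a x)).
Proof.
move=> sal sa; apply: (@smooth_in_local _ _ _ setT) => x _.
have [i ix] := @triv_cover _ _ _ A x; exists (triv_dom i) => //.
have oi := @triv_dom_open _ _ _ A i.
refine (eq_smooth_in oi _ (smooth_in_sum (index_enum 'I_(rank A)) (P := xpredT) oi
  (fun k _ => smooth_inM oi (sa i k) (sal i k)))) => y iy.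
rewrite [in RHS](frame_expand (a y) iy) linear_sum; apply: eq_bigr => k _.
by rewrite linearZ /= coord_coframe.
Qed.

(** A global substitute for a local frame and its dual: both are cut off by the
    same bump function [f], so that $w=f^2$. Multiplying by [w] replaces a
    section by a finite combination of global sections without changing its
    value at [x]. *)
Lemma local_resolution x : exists (w : M -> R) (e : 'I_(rank A) -> section A)
    (eps : 'I_(rank A) -> section (dual_bundle A)),
  [/\ smooth_fun w, w x = 1, forall k, smooth_section (e k),
      forall k, smooth_section (eps k) &
      forall y (v : A y), w y *: v = \sum_k eps k y v *: e k y].
Proof.
have [i ix] := @triv_cover _ _ _ A x.
have [f [sf fx [K [cK Ki fK]]]] := bump_fun (@triv_dom_open _ _ _ A i) ix.
exists (fun y => f y * f y), (fun k y => f y *: (frame i y)`_k),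
  (fun k y => f y *: (coframe i y)`_k); split.
- by apply: smooth_inM => //; exact: openT.
- by rewrite fx mulr1.
- by move=> k; exact: smooth_cutoff_frame sf cK Ki fK.
- by move=> k; exact: (@smooth_cutoff_frame (dual_bundle A) i k f K).
- move=> y v; have [Ky|nKy] := pselect (K y); last first.
    rewrite big1 ?fK ?mul0r ?scale0r// => k _.
    by rewrite [X in _ *: X]scale0r scaler0.
  rewrite [in LHS](frame_expand v (Ki y Ky)) scaler_sumr; apply: eq_bigr => k _.
  by rewrite !scalerA lfunE /= coframeE; congr (_ *: _); rewrite /GRing.scale /=; ring.
Qed.

End Dual.

End SmoothSections.

(** * Alternating fields of degree at most three *)

Section TupleSums.
Context {V : nmodType} {T : finType}.

Lemma big_tuple_nil (F : seq T -> V) : \sum_(t : 0.-tuple T) F t = F [::].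
Proof.
rewrite (big_pred1 [tuple])// => t; apply/esym/eqP.
by rewrite tuple0.
Qed.

Lemma big_tuple_cons k (F : seq T -> V) :
  \sum_(t : k.+1.-tuple T) F t = \sum_(b : T) \sum_(t : k.-tuple T) F (b :: t).
Proof.
rewrite pair_big /= (reindex (fun p : T * k.-tuple T => [tuple of p.1 :: p.2])) //=.
exists (fun t : k.+1.-tuple T => (thead t, [tuple of behead t])) => /=.
  by move=> [b t] _ /=; rewrite theadE; congr (_, _); apply/val_inj.
by move=> t _; rewrite -tuple_eta.
Qed.

End TupleSums.

Section BitSums.
Context {V : nmodType}.
Implicit Type F : bitseq -> V.

Lemma big_bits1 F :
  \sum_(m : 1.-tuple bool) F m = F [:: true] + F [:: false].
Proof. by rewrite big_tuple_cons big_bool /= !(big_tuple_nil (fun m => F (_ :: m))). Qed.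

Lemma big_bits2 F : \sum_(m : 2.-tuple bool) F m =
  (F [:: true; true] + F [:: true; false])
  + (F [:: false; true] + F [:: false; false]).
Proof. by rewrite big_tuple_cons big_bool /= !(big_bits1 (fun m => F (_ :: m))). Qed.

Lemma big_bits3 F : \sum_(m : 3.-tuple bool) F m =
  ((F [:: true; true; true] + F [:: true; true; false])
   + (F [:: true; false; true] + F [:: true; false; false]))
  + ((F [:: false; true; true] + F [:: false; true; false])
   + (F [:: false; false; true] + F [:: false; false; false])).
Proof. by rewrite big_tuple_cons big_bool /= !(big_bits2 (fun m => F (_ :: m))). Qed.

End BitSums.

Section Alternating.
Context {R : realType} {n : nat} {M : smooth_manifold R n} {E : vector_bundle M}.
Implicit Types (P Q : altfield E).

Section Slot.
Variables (P : altfield E) (sP : smooth_alternating P) (x : M) (s1 s2 : seq (E x)).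
Arguments P : clear implicits.

Lemma alt_slotD u v :
  P x (s1 ++ (u + v) :: s2) = P x (s1 ++ u :: s2) + P x (s1 ++ v :: s2).
Proof. by rewrite -{1}[u]scale1r (alt_linear sP) mul1r. Qed.

Lemma alt_slot0 : P x (s1 ++ 0 :: s2) = 0.
Proof. by apply: (addrI (P x (s1 ++ 0 :: s2))); rewrite -alt_slotD !addr0. Qed.

Lemma alt_slotZ c u : P x (s1 ++ (c *: u) :: s2) = c * P x (s1 ++ u :: s2).
Proof. by rewrite -[c *: u]addr0 (alt_linear sP) alt_slot0 addr0. Qed.

Lemma alt_slot_sum (I : Type) (r : seq I) (F : I -> E x) :
  P x (s1 ++ (\sum_(i <- r) F i) :: s2) = \sum_(i <- r) P x (s1 ++ F i :: s2).
Proof.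
elim: r => [|i r IH]; first by rewrite !big_nil alt_slot0.
by rewrite !big_cons alt_slotD IH.
Qed.

End Slot.

Lemma alt_skew P x (u v : E x) : smooth_alternating P ->
  P x [:: u; v] = - P x [:: v; u].
Proof.
move=> sP; have A := alt_alternating sP [::] [::] [::].
have := A x (u + v); rewrite /= (alt_slotD sP [::]) /=.
rewrite (alt_slotD sP [:: u] [::]) (alt_slotD sP [:: v] [::]) /= !A.
by rewrite add0r addr0 => /eqP; rewrite addr_eq0 => /eqP.
Qed.

Lemma smooth_alt2_eval P (a b : section E) : smooth_alternating P ->
  smooth_section a -> smooth_section b ->
  smooth_fun (fun x => P x [:: a x; b x]).
Proof.
move=> sP sa sb; apply: (@smooth_in_local _ _ _ setT) => x _.
have [i ix] := @triv_cover _ _ _ E x; exists (triv_dom i) => //.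
have oi := @triv_dom_open _ _ _ E i.
refine (eq_smooth_in oi _ (smooth_in_sum (index_enum 'I_(rank E)) (P := xpredT)
  oi (fun k _ => smooth_in_sum (index_enum 'I_(rank E)) (P := xpredT)
  oi (fun l _ => smooth_inM oi (smooth_inM oi (sa i k) (sb i l))
  (alt_smooth sP [:: k; l]))))) => y iy.
rewrite [in RHS](frame_expand (a y) iy) (alt_slot_sum sP [::]).
apply: eq_bigr => k _; rewrite [in RHS](frame_expand (b y) iy).
rewrite (alt_slotZ sP [::]) (alt_slot_sum sP [:: _] [::]) mulr_sumr.
apply: eq_bigr => l _; rewrite (alt_slotZ sP [:: _] [::]) /=; ring.
Qed.

Definition alt0 (f : M -> R) : altfield E :=
  fun x s => if s is [::] then f x else 0.

Definition alt1 (F : forall x, E x -> R) : altfield E :=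
  fun x s => if s is [:: u] then F x u else 0.

Definition alt2 (B : forall x, E x -> E x -> R) : altfield E :=
  fun x s => if s is [:: u; v] then B x u v else 0.

Lemma homogeneous_alt0 f : smooth_fun f -> homogeneous 0 (alt0 f).
Proof.
move=> sf; split; last by move=> x [].
split.
- by move=> x [|? ?] s2 c u v /=; rewrite mulr0 addr0.
- by move=> x [|? ?].
- move=> i [|k ks]; [exact: smooth_fun_in | exact: smooth_in_cst].
Qed.

Lemma homogeneous_alt1 F :
  (forall x c u v, F x (c *: u + v) = c * F x u + F x v) ->
  (forall i (k : 'I_(rank E)), smooth_in (triv_dom i) (fun x => F x (frame i x)`_k)) ->
  homogeneous 1 (alt1 F).
Proof.
move=> linF sF; split; last by move=> x [|? []].
split.
- move=> x [|? [|? ?]] [|? ?] c u v /=; rewrite ?linF ?mulr0 ?addr0//.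
- by move=> x [|? [|? ?]] [|? ?].
- by move=> i [|k [|l ks]]; [exact: smooth_in_cst | exact: sF | exact: smooth_in_cst].
Qed.

Lemma homogeneous_alt2 B :
  (forall x c u v w, B x (c *: u + v) w = c * B x u w + B x v w) ->
  (forall x u v, B x u v = - B x v u) ->
  (forall i (k l : 'I_(rank E)),
     smooth_in (triv_dom i) (fun x => B x (frame i x)`_k (frame i x)`_l)) ->
  homogeneous 2 (alt2 B).
Proof.
move=> linB skB sB; split; last by move=> x [|? [|? []]].
have Bxx x u : B x u u = 0.
  by have := skB x u u; lra.
split.
- move=> x [|a [|b [|? ?]]] [|? [|? ?]] c u v /=; rewrite ?linB ?mulr0 ?addr0//.
  by rewrite !(skB _ a) linB opprD mulrN.
- by move=> x [|? [|? [|? ?]]] [|? [|? ?]] [|? ?] u //=.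
- by move=> i [|k [|l [|m ks]]]; do ?[exact: smooth_in_cst | exact: sB].
Qed.

Lemma homogeneous_alt_add k c P Q : homogeneous k P -> homogeneous k Q ->
  homogeneous k (alt_add c P Q).
Proof.
move=> [sP hP] [sQ hQ]; rewrite /alt_add; split; last first.
  by move=> x s sk; rewrite hP// hQ// mulr0 addr0.
split.
- by move=> x s1 s2 d u v; rewrite (alt_linear sP) (alt_linear sQ); ring.
- by move=> *; rewrite (alt_alternating sP) (alt_alternating sQ) mulr0 addr0.
- move=> i ks; have oi := @triv_dom_open _ _ _ E i.
  apply: smooth_inD => //; last exact: (alt_smooth sQ).
  by apply: smooth_inM => //; [exact: smooth_in_cst | exact: (alt_smooth sP)].
Qed.

Lemma homogeneous_alt_zero k : homogeneous k (alt_zero E).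
Proof.
split=> //; split=> // *; first by rewrite /alt_zero mulr0 addr0.
exact: smooth_in_cst.
Qed.

Section Wedge.
Variables (k l : nat) (P Q : altfield E).
Arguments P : clear implicits.
Arguments Q : clear implicits.
Hypotheses (hP : forall x s, size s <> k -> P x s = 0).
Hypotheses (hQ : forall x s, size s <> l -> Q x s = 0).

Lemma wedge_degree x s : size s <> (k + l)%N -> wedge P Q x s = 0.
Proof.
move=> skl; rewrite /wedge big1// => m _.
have sz : (size (mask m s) + size (mask (map negb m) s))%N = size s.
  rewrite !size_mask ?size_map ?size_tuple//.
  by rewrite count_map -[RHS](size_tuple m) -(count_predC id).
have [mk|mk] := eqVneq (size (mask m s)) k; last first.
  by rewrite hP ?mulr0 ?mul0r//; exact/eqP.
by rewrite hQ ?mulr0// => ml; apply: skl; rewrite -sz mk ml.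
Qed.

End Wedge.

Let wedge_term P Q x s (m : bitseq) :=
  (-1) ^+ inversions m * P x (mask m s) * Q x (mask (map negb m) s).

Lemma wedge_nil P Q x : wedge P Q x [::] = P x [::] * Q x [::].
Proof. rewrite /wedge (big_tuple_nil (wedge_term P Q [::])) /wedge_term /=; ring. Qed.

Lemma wedge_seq1 P Q x u :
  wedge P Q x [:: u] = P x [:: u] * Q x [::] + P x [::] * Q x [:: u].
Proof. rewrite /wedge (big_bits1 (wedge_term P Q [:: u])) /wedge_term /=; ring. Qed.

Lemma wedge_seq2 P Q x u v : wedge P Q x [:: u; v] =
  P x [:: u; v] * Q x [::] + P x [:: u] * Q x [:: v]
  - P x [:: v] * Q x [:: u] + P x [::] * Q x [:: u; v].
Proof. rewrite /wedge (big_bits2 (wedge_term P Q [:: u; v])) /wedge_term /=; ring. Qed.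

Lemma wedge_seq3 P Q x u v w : wedge P Q x [:: u; v; w] =
  P x [:: u; v; w] * Q x [::] + P x [:: u; v] * Q x [:: w]
  - P x [:: u; w] * Q x [:: v] + P x [:: v; w] * Q x [:: u]
  + P x [:: u] * Q x [:: v; w] - P x [:: v] * Q x [:: u; w]
  + P x [:: w] * Q x [:: u; v] + P x [::] * Q x [:: u; v; w].
Proof.
rewrite /wedge (big_bits3 (wedge_term P Q [:: u; v; w])) /wedge_term /=; ring.
Qed.

End Alternating.

(** * Tensoriality and pairings *)

Section Tensoriality.
Context {R : realType} {n : nat} {M : smooth_manifold R n} {A : vector_bundle M}.

(** For the functions of [local_resolution], $w\,a=\sum_k\varepsilon_k(a)e_k$
    gives $C(a)=\sum_k\varepsilon_k(a)(x)\,C(e_k)$, which sees only [a x]. *)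
Lemma tensorial_pointwise (x : M) (C : section A -> R) :
  (forall c a b, smooth_section a -> smooth_section b ->
     C (fun y => c *: a y + b y) = c * C a + C b) ->
  (forall f a, smooth_fun f -> smooth_section a ->
     C (fun y => f y *: a y) = f x * C a) ->
  forall a b, smooth_section a -> smooth_section b -> a x = b x -> C a = C b.
Proof.
move=> linC tensC a b sa sb ab.
have [w [e [eps [sw wx se seps we]]]] := local_resolution (A := A) x.
have C0 : C (fun=> 0) = 0.
  have := linC (-1) _ _ (@smooth_section0 _ _ _ A) (@smooth_section0 _ _ _ A).
  rewrite mulN1r addNr => <-; apply: (congr1 C).
  by apply: functional_extensionality_dep => y; rewrite scaler0 addr0.
suff CE d : smooth_section d -> C d = \sum_k eps k x (d x) * C (e k).
  by rewrite !CE// ab.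
move=> sd; rewrite -[LHS]mul1r -wx -tensC//.
rewrite (functional_extensionality_dep (fun y => we y (d y))).
have sk k : smooth_section (fun y => eps k y (d y) *: e k y).
  by apply: smooth_sectionZ => //; exact: smooth_covector_eval.
elim: (index_enum _) => [|k r IH].
  rewrite big_nil -[RHS]C0; apply: (congr1 C).
  by apply: functional_extensionality_dep => y; rewrite big_nil.
rewrite big_cons -IH -(tensC (fun y => eps k y (d y)))//; last first.
  exact: smooth_covector_eval.
rewrite -[X in _ = X + _]mul1r -linC//; last exact: smooth_section_sum.
by apply: (congr1 C); apply: functional_extensionality_dep => y; rewrite big_cons scale1r.
Qed.

End Tensoriality.

Section Pairing.
Context {R : realType} {n : nat} {M : smooth_manifold R n} {A : vector_bundle M}.
Implicit Types (P : altfield (dual_bundle A)) (be ga : section (dual_bundle A)).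

Lemma pairing2 P (B : forall x, A x -> A x -> R) x :
  pairing 2 P (alt2 B) x = 2^-1 * \sum_i \sum_j
    P x [:: linfun (coord (vbasis {: A x}) i : A x -> R^o);
            linfun (coord (vbasis {: A x}) j : A x -> R^o)]
    * B x (vbasis {: A x})`_i (vbasis {: A x})`_j.
Proof.
rewrite /pairing; congr (_ * _).
pose F (t : seq 'I_(\dim {: A x})) :=
  P x [seq linfun (coord (vbasis {: A x}) i : A x -> R^o) | i <- t]
  * alt2 B [seq (vbasis {: A x})`_(i : 'I_(\dim {: A x})) | i <- t].
rewrite (big_tuple_cons _ F); apply: eq_bigr => i _.
rewrite (big_tuple_cons _ (fun t => F (i :: t))); apply: eq_bigr => j _.
by rewrite (big_tuple_nil (fun t => F (i :: j :: t))).
Qed.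

Lemma pairing2D P (B1 B2 : forall x, A x -> A x -> R) x :
  pairing 2 P (alt2 (fun y u v => B1 y u v + B2 y u v)) x
  = pairing 2 P (alt2 B1) x + pairing 2 P (alt2 B2) x.
Proof.
rewrite !pairing2 -mulrDr -big_split /=; congr (_ * _); apply: eq_bigr => i _.
by rewrite -big_split /=; apply: eq_bigr => j _; rewrite mulrDr.
Qed.

Lemma dual_vbasis_expand x (al : dual_bundle A x) :
  al = \sum_(i < \dim {: A x}) al (vbasis {: A x})`_i
         *: (linfun (coord (vbasis {: A x}) i : A x -> R^o) : dual_bundle A x).
Proof.
apply/lfunP => v; rewrite {1}(coord_vbasis (memvf v)) linear_sum sum_lfunE.
apply: eq_bigr => i _; rewrite linearZ /= !lfunE /= lfunE.
exact: mulrC.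
Qed.

Lemma covectorP x (al : dual_bundle A x) (c : R) (u v : A x) :
  al (c *: u + v) = c * al u + al v.
Proof. exact: linearP. Qed.

Definition cowedge be ga x (u v : A x) : R :=
  be x u * ga x v - be x v * ga x u.

Lemma homogeneous_cowedge be ga : smooth_section be -> smooth_section ga ->
  homogeneous 2 (alt2 (cowedge be ga)).
Proof.
move=> sbe sga; apply: homogeneous_alt2.
- by move=> x c u v w; rewrite /cowedge !covectorP; ring.
- by move=> x u v; rewrite /cowedge; ring.
move=> i k l; have oi := @triv_dom_open _ _ _ A i.
have s1 (al : section (dual_bundle A)) (m : 'I_(rank A)) :
    smooth_section al ->
    smooth_in (triv_dom i) (fun x => al x (frame i x)`_m).
  move=> sal; refine (eq_smooth_in oi _ (sal i m)) => x ix.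
  by rewrite /= coord_coframe.
refine (eq_smooth_in oi _ (smooth_inD oi (smooth_inM oi (s1 _ k sbe) (s1 _ l sga))
  (smooth_inM oi (smooth_in_cst (-1)) (smooth_inM oi (s1 _ l sbe) (s1 _ k sga))))).
by move=> x ix; rewrite /cowedge; ring.
Qed.

(** Decomposable 2-forms recover the values of a bivector field, so that its Lie
    derivative, which is given by duality, becomes explicit. *)
Lemma pairing_cowedge P be ga x : smooth_alternating P ->
  pairing 2 P (alt2 (cowedge be ga)) x = P x [:: be x; ga x].
Proof.
move=> sP; have PE al al' : P x [:: al; al'] =
    \sum_(i < \dim {: A x}) \sum_(j < \dim {: A x})
    P x [:: linfun (coord (vbasis {: A x}) i : A x -> R^o);
            linfun (coord (vbasis {: A x}) j : A x -> R^o)]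
    * (al (vbasis {: A x})`_i * al' (vbasis {: A x})`_j).
  rewrite {1}[al]dual_vbasis_expand (alt_slot_sum sP [::]).
  apply: eq_bigr => i _; rewrite (alt_slotZ sP [::]) {1}[al']dual_vbasis_expand.
  rewrite (alt_slot_sum sP [:: _] [::]) mulr_sumr; apply: eq_bigr => j _.
  by rewrite (alt_slotZ sP [:: _] [::]) /=; ring.
rewrite pairing2 /cowedge.
have -> : P x [:: be x; ga x]
    = 2^-1 * (P x [:: be x; ga x] - P x [:: ga x; be x]).
  by rewrite [X in _ - X](alt_skew _ _ sP); lra.
congr (_ * _); rewrite !PE -sumrB; apply: eq_bigr => i _.
by rewrite -sumrB; apply: eq_bigr => j _; ring.
Qed.

End Pairing.

(** * Anchor and Lie derivatives *)

Section Anchor.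
Context {R : realType} {n : nat} {M : smooth_manifold R n} {A : vector_bundle M}.
Context (L : skew_algebroid A).
Implicit Types (f h : M -> R) (a b : section A).

Section Pointwise.
Context {x : M} (v : A x).
Let tv := anchor_tangent L v.

Lemma anchorD f h : smooth_fun f -> smooth_fun h ->
  anchor L v (fun y => f y + h y) = anchor L v f + anchor L v h.
Proof.
move=> sf sh; rewrite -[X in X + _]mul1r -(tangent_linear tv)//.
by congr anchor; apply/funext => y; rewrite mul1r.
Qed.

Lemma anchor0 : anchor L v (fun=> 0) = 0.
Proof.
have s0 : smooth_fun (M := M) (fun=> 0) by exact: smooth_in_cst.
apply: (addrI (anchor L v (fun=> 0))); rewrite addr0 -anchorD//.
by congr anchor; apply/funext => y; rewrite addr0.
Qed.

Lemma anchor_cst c : anchor L v (fun=> c) = 0.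
Proof.
have s1 : smooth_fun (M := M) (fun=> 1) by exact: smooth_in_cst.
have D1 : anchor L v (fun=> 1) = 0.
  have := tangent_leibniz tv s1 s1; rewrite (_ : (fun y => 1 * 1) = fun=> 1).
    by rewrite mul1r; lra.
  by apply/funext => y; rewrite mulr1.
have := tangent_linear tv c s1 (smooth_in_cst 0).
by rewrite mulr1 addr0 D1 anchor0 mulr0 addr0.
Qed.

Lemma anchorZ c f : smooth_fun f -> anchor L v (fun y => c * f y) = c * anchor L v f.
Proof.
move=> sf; rewrite -[RHS]addr0 -anchor0 -(tangent_linear tv)//.
  by congr anchor; apply/funext => y; rewrite addr0.
exact: smooth_in_cst.
Qed.

Lemma anchorM f h : smooth_fun f -> smooth_fun h ->
  anchor L v (fun y => f y * h y) = f x * anchor L v h + h x * anchor L v f.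
Proof. exact: tangent_leibniz. Qed.

Lemma anchorN f : smooth_fun f -> anchor L v (fun y => - f y) = - anchor L v f.
Proof.
move=> sf; rewrite -mulN1r -anchorZ//.
by congr anchor; apply/funext => y; rewrite mulN1r.
Qed.

End Pointwise.

Lemma anchor_vectorD x (u v : A x) f : smooth_fun f ->
  anchor L (u + v) f = anchor L u f + anchor L v f.
Proof. by move=> sf; rewrite -{1}[u]scale1r anchor_linear// mul1r. Qed.

Lemma anchor_vector0 x f : smooth_fun f -> anchor L (0 : A x) f = 0.
Proof.
by move=> sf; apply: (addrI (anchor L (0 : A x) f)); rewrite -anchor_vectorD// !addr0.
Qed.

Lemma anchor_vectorZ x c (u : A x) f : smooth_fun f ->
  anchor L (c *: u) f = c * anchor L u f.
Proof.
by move=> sf; rewrite -[c *: u]addr0 anchor_linear// anchor_vector0// addr0.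
Qed.

Lemma smooth_anchor a f : smooth_section a -> smooth_fun f ->
  smooth_fun (fun x => anchor L (a x) f).
Proof.
move=> sa sf; apply: (@smooth_in_local _ _ _ setT) => x _.
have [i ix] := @triv_cover _ _ _ A x; exists (triv_dom i) => //.
have oi := @triv_dom_open _ _ _ A i.
refine (eq_smooth_in oi _ (smooth_in_sum (index_enum 'I_(rank A)) (P := xpredT)
  oi (fun k _ => smooth_inM oi (sa i k) (anchor_smooth L (i := i) k sf)))) => y iy.
rewrite [in RHS](frame_expand (a y) iy).
elim: (index_enum _) => [|k r IH]; first by rewrite !big_nil anchor_vector0.
by rewrite !big_cons anchor_vectorD// anchor_vectorZ// IH.
Qed.

Lemma bracketD a b c : smooth_section a -> smooth_section b -> smooth_section c ->
  forall x, bracket L a (fun y => b y + c y) x = bracket L a b x + bracket L a c x.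
Proof.
move=> sa sb sc x; rewrite -[X in X + _]scale1r -bracket_linear//.
congr (bracket L a _ x); apply: functional_extensionality_dep => y.
by rewrite scale1r.
Qed.

End Anchor.

Section LieDerivativeForms.
Context {R : realType} {n : nat} {M : smooth_manifold R n} {A : vector_bundle M}.
Context (L : skew_algebroid A).
Implicit Types (a b : section A) (al be ga : section (dual_bundle A)).
Implicit Types (eta : altfield A).

(** Every finite list of vectors at [x] consists of values of smooth sections, so
    the defining identity of the Lie derivative determines all values. *)
Lemma is_lie_form_unique a eta eta1 eta2 :
  is_lie_form L a eta eta1 -> is_lie_form L a eta eta2 -> eta1 = eta2.
Proof.
move=> [_ E1] [_ E2]; apply: functional_extensionality_dep => x.
apply/funext => s.
have [ss [sss <-]] : exists ss : seq (section A),
    (forall i, (i < size ss)%N -> smooth_section (nth a ss i)) /\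
    [seq t x | t <- ss] = s.
  elim: s => [|v s [ss [sss <-]]]; first by exists [::].
  have [b sb <-] := smooth_section_through v.
  by exists (b :: ss); split=> // -[|i] //=; exact: sss.
by rewrite E1// E2.
Qed.

Lemma lie_formE a eta eta' : is_lie_form L a eta eta' -> lie_form L a eta = eta'.
Proof.
move=> H; apply: is_lie_form_unique (H).
exact: (@xgetI _ _ [set eta' | is_lie_form L a eta eta'] eta' H).
Qed.

Lemma is_lie_form_homogeneous k a eta eta' :
  homogeneous k eta -> homogeneous k eta' ->
  (forall ss : seq (section A), size ss = k ->
    (forall i, (i < size ss)%N -> smooth_section (nth a ss i)) ->
    forall x, eta' x [seq s x | s <- ss]
      = anchor L (a x) (fun y => eta y [seq s y | s <- ss])
        - \sum_(i < size ss)
            eta x [seq s x | s <- set_nth a ss i (bracket L a (nth a ss i))]) ->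
  is_lie_form L a eta eta'.
Proof.
move=> [_ h0] [s' h0'] E; split=> // ss sss x.
have [sk|/eqP sk] := eqVneq (size ss) k; first exact: E.
rewrite h0' ?size_map// big1 ?subr0 => [|i _]; last first.
  by rewrite h0// size_map size_set_nth (maxn_idPr (ltn_ord i)).
rewrite -(anchor0 L (a x)); congr anchor; apply/funext => y.
by rewrite h0// size_map.
Qed.

(** The value on [b] of the Lie derivative of the covector field [al] along [a]. *)
Definition lie_pairing a al b (x : M) : R :=
  anchor L (a x) (fun y => al y (b y)) - al x (bracket L a b x).

Lemma lie_pairingP a al c b d x : smooth_section a -> smooth_section al ->
  smooth_section b -> smooth_section d ->
  lie_pairing a al (fun y => c *: b y + d y) x
  = c * lie_pairing a al b x + lie_pairing a al d x.
Proof.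
move=> sa sal sb sd; rewrite /lie_pairing bracket_linear// covectorP.
under [X in anchor L _ X]eq_fun do rewrite covectorP.
rewrite (tangent_linear (anchor_tangent L (a x))); [|exact: smooth_covector_eval..].
ring.
Qed.

Lemma lie_pairing_local a al b b' x : smooth_section a -> smooth_section al ->
  smooth_section b -> smooth_section b' -> b x = b' x ->
  lie_pairing a al b x = lie_pairing a al b' x.
Proof.
move=> sa sal.
apply: (tensorial_pointwise (C := fun b => lie_pairing a al b x)).
- by move=> c d e sd se; exact: lie_pairingP.
- move=> f d sf sd; rewrite /lie_pairing bracket_leibniz// covectorP.
  under [X in anchor L _ X]eq_fun do rewrite linearZ /=.
  rewrite anchorM//; last exact: smooth_covector_eval.
  by rewrite linearZ /= /GRing.scale /=; ring.
Qed.

(** The Lie derivative is selected by a choice operator, so it is meaningful only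
    once some field is known to satisfy its definition. [lie_pairing] depends on
    [b] only through its value at the point, which defines [T]. For smoothness,
    a frame vector is the quotient by a bump function of a global section. *)
Lemma lie_covector_exists a al : smooth_section a -> smooth_section al ->
  exists2 T : forall x, A x -> R, homogeneous 1 (alt1 T) &
    forall b, smooth_section b -> forall x, T x (b x) = lie_pairing a al b x.
Proof.
move=> sa sal.
have ext (x : M) (v : A x) : {b : section A | smooth_section b /\ b x = v}.
  by apply: cid; have [b sb bx] := smooth_section_through v; exists b.
pose T x (v : A x) := lie_pairing a al (sval (ext x v)) x.
have TE b x : smooth_section b -> T x (b x) = lie_pairing a al b x.
  move=> sb; rewrite /T; case: (ext x (b x)) => b' [sb' b'x] /=.
  exact: lie_pairing_local.
have linT x c u v : T x (c *: u + v) = c * T x u + T x v.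
  have [b sb <-] := smooth_section_through u.
  have [d sd <-] := smooth_section_through v.
  rewrite (TE (fun y => c *: b y + d y)); last first.
    by apply: smooth_sectionD => //; apply: smooth_sectionZ => //; exact: smooth_in_cst.
  by rewrite !TE// lie_pairingP.
have T0 x : T x 0 = 0 by have := linT x (-1) 0 0; rewrite scaler0 addr0; lra.
exists T; last by move=> b sb x; exact: TE.
apply: homogeneous_alt1 => // i k; apply: smooth_in_local => x ix.
have [f [sf fx [K [cK Ki fK]]]] := bump_fun (@triv_dom_open _ _ _ A i) ix.
exists [set y | f y != 0]; first by rewrite /= fx oner_eq0.
have sb := smooth_cutoff_frame k sf cK Ki fK.
have of0 := smooth_fun_neq0_open sf.
have sC : smooth_fun (lie_pairing a al (fun y => f y *: (frame i y)`_k)).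
  apply: smooth_inD; first exact: openT.
    by apply: smooth_anchor => //; exact: smooth_covector_eval.
  refine (eq_smooth_in openT _ (smooth_inM openT (smooth_in_cst (-1))
    (smooth_covector_eval sal (bracket_smooth L sa sb)))) => y _.
  by rewrite mulN1r.
refine (eq_smooth_in of0 _ (smooth_inM of0 (smooth_inV of0 (fun _ fy => fy)
  (smooth_fun_in sf)) (smooth_fun_in sC))) => y fy.
rewrite -(TE (fun y => f y *: (frame i y)`_k) y sb) -[f y *: _]addr0 linT T0 addr0.
by rewrite mulKf.
Qed.

Lemma is_lie_form_covector a al (T : forall x, A x -> R) :
  smooth_section a -> smooth_section al -> homogeneous 1 (alt1 T) ->
  (forall b, smooth_section b -> forall x, T x (b x) = lie_pairing a al b x) ->
  is_lie_form L a (covector_alt al) (alt1 T).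
Proof.
move=> sa sal hT TE; apply: (@is_lie_form_homogeneous 1) => //.
  apply: (homogeneous_alt1 (F := fun x (v : A x) => al x v)).
    by move=> x c u v; exact: covectorP.
  move=> i k; refine (eq_smooth_in _ _ (sal i k)); first exact: triv_dom_open.
  by move=> x ix; rewrite /= coord_coframe.
move=> [|b []]//= _ sb x; rewrite TE; last exact: (sb 0%N).
by rewrite big_ord_recl big_ord0 addr0.
Qed.

Lemma lie_form1E a al b x : smooth_section a -> smooth_section al ->
  smooth_section b -> lie_form1 L a al x (b x) = lie_pairing a al b x.
Proof.
move=> sa sal sb; have [T hT TE] := lie_covector_exists sa sal.
rewrite /lie_form1 (lie_formE (is_lie_form_covector sa sal hT TE)) /=.
have linT : linear (T x : A x -> R^o).
  by move=> c u v; have := alt_linear hT.1 [::] [::] c u v.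
pose T' : {linear A x -> R^o} := HB.pack (T x : A x -> R^o)
  (GRing.isLinear.Build _ _ _ _ _ linT).
by rewrite (_ : (fun v : A x => T x v) = T')// lfunE /= TE.
Qed.

Lemma smooth_lie_form1 a al : smooth_section a -> smooth_section al ->
  smooth_section (lie_form1 L a al).
Proof.
move=> sa sal i k; have [T hT TE] := lie_covector_exists sa sal.
refine (eq_smooth_in _ _ (alt_smooth hT.1 (i := i) [:: k])).
  exact: triv_dom_open.
move=> x ix; rewrite /= coord_coframe//.
suff Tv v : T x v = lie_form1 L a al x v by exact: Tv.
by have [b sb <-] := smooth_section_through v; rewrite lie_form1E// TE.
Qed.

(** The Leibniz rule for the exterior product provides the 2-form that satisfies
    the definition; uniqueness identifies it with the Lie derivative. *)
Lemma lie_form_cowedge a be ga : smooth_section a -> smooth_section be ->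
  smooth_section ga ->
  lie_form L a (alt2 (cowedge be ga))
  = alt2 (fun x u v => cowedge (lie_form1 L a be) ga u v
                       + cowedge be (lie_form1 L a ga) u v).
Proof.
move=> sa sbe sga; apply: lie_formE.
have [sLbe sLga] := (smooth_lie_form1 sa sbe, smooth_lie_form1 sa sga).
apply: (@is_lie_form_homogeneous 2).
- exact: homogeneous_cowedge.
- have := homogeneous_alt_add 1 (homogeneous_cowedge sLbe sga)
    (homogeneous_cowedge sbe sLga).
  congr homogeneous; apply: functional_extensionality_dep => x.
  apply/funext => -[|u [|v []]]; rewrite /alt_add /= ?mulr0 ?addr0//.
  by rewrite mul1r.
move=> [|b [|c []]]//= _ sbc x.
have [sb sc] := (sbc 0%N isT, sbc 1%N isT); rewrite /= in sb sc.
rewrite big_ord_recl big_ord_recl big_ord0 addr0 /= /cowedge.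
rewrite !lie_form1E// /lie_pairing.
have se := smooth_covector_eval.
rewrite anchorD; [|by do ?[exact: se | apply: smooth_funM | apply: smooth_funN]..].
rewrite anchorN; [|by do ?[exact: se | apply: smooth_funM]].
rewrite !anchorM; [|exact: se..].
ring.
Qed.

Lemma lie_bivectorE a (P Q : altfield (dual_bundle A)) be ga x :
  smooth_section a -> homogeneous 2 P -> is_lie_multivector L 2 a P Q ->
  smooth_section be -> smooth_section ga ->
  Q x [:: be x; ga x] = anchor L (a x) (fun y => P y [:: be y; ga y])
    - P x [:: lie_form1 L a be x; ga x] - P x [:: be x; lie_form1 L a ga x].
Proof.
move=> sa [sP _] [[sQ _] E] sbe sga.
have := E _ (homogeneous_cowedge sbe sga) x.
rewrite lie_form_cowedge// pairing2D !pairing_cowedge// => ->.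
rewrite opprD addrA; congr (anchor _ _ _ - _ - _).
by apply/funext => y; rewrite pairing_cowedge.
Qed.

End LieDerivativeForms.

(** * The Schouten bracket of two bivector fields *)

Section Sharp.
Context {R : realType} {n : nat} {M : smooth_manifold R n} {A : vector_bundle M}.
Implicit Types (P Q : altfield (dual_bundle A)) (al be : section (dual_bundle A)).

Lemma covector_separates x (u v : A x) :
  (forall al : dual_bundle A x, al u = al v) -> u = v.
Proof.
move=> uv; have [i ix] := @triv_cover _ _ _ A x.
rewrite (frame_expand u ix) (frame_expand v ix); apply: eq_bigr => k _.
by rewrite -!coframeE uv.
Qed.

Lemma sharpE P x (al be : dual_bundle A x) : smooth_alternating P ->
  be (sharp P x al) = P x [:: al; be].
Proof.
move=> sP; have [i ix] := @triv_cover _ _ _ A x.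
pose S (al : dual_bundle A x) : A x :=
  \sum_(k < rank A) P x [:: al; (coframe i x)`_k] *: (frame i x)`_k.
have linS : linear S.
  move=> c u v; rewrite /S scaler_sumr -big_split /=; apply: eq_bigr => k _.
  by rewrite (alt_linear sP [::]) scalerDl scalerA.
pose S' : {linear dual_bundle A x -> A x} := HB.pack S
  (GRing.isLinear.Build _ _ _ _ _ linS).
move: al be; rewrite /sharp.
pose X := [set T : 'Hom(dual_bundle A x, A x) |
  forall al be : dual_bundle A x, be (T al) = P x [:: al; be]].
apply: (@xgetI _ _ X (linfun S')) => al be.
rewrite lfunE /= /S linear_sum [in RHS](coframe_expand be ix).
rewrite (alt_slot_sum sP [:: _] [::]); apply: eq_bigr => k _.
by rewrite (alt_slotZ sP [:: _] [::]) linearZ /= mulrC.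
Qed.

Lemma smooth_sharp P al : smooth_alternating P -> smooth_section al ->
  smooth_section (fun x => sharp P x (al x)).
Proof.
move=> sP sal i k; have oi := @triv_dom_open _ _ _ A i.
refine (eq_smooth_in oi _ (smooth_in_sum (index_enum 'I_(rank A)) (P := xpredT) oi
  (fun l _ => smooth_inM oi (sal i l) (alt_smooth sP [:: l; k])))) => x ix.
rewrite -coframeE sharpE// [in RHS](frame_expand (al x) ix) (alt_slot_sum sP [::]).
by apply: eq_bigr => l _; rewrite (alt_slotZ sP [::]).
Qed.

Lemma sharp_unique P x (al : dual_bundle A x) (v : A x) : smooth_alternating P ->
  (forall be : dual_bundle A x, be v = P x [:: al; be]) -> sharp P x al = v.
Proof. by move=> sP Pv; apply: covector_separates => be; rewrite Pv sharpE. Qed.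

End Sharp.

Section SchoutenFormula.
Context {R : realType} {n : nat} {M : smooth_manifold R n} {A : vector_bundle M}.
Context (L : skew_algebroid A).
Implicit Types (P Q : altfield (dual_bundle A)) (al be ga : section (dual_bundle A)).
Implicit Types (a b : section A).

(** The sum over cyclic permutations polarises
    $[\Pi,\Pi](\alpha,\beta,\gamma)=2\sum_{cyc}\big(\rho(\sharp_\Pi\alpha)\cdot\Pi(\beta,\gamma)
    -\alpha([\sharp_\Pi\beta,\sharp_\Pi\gamma])\big)$. Unlike this quadratic expression, its
    polarisation is additive in the second bivector field. *)
Definition schouten_term P Q al be ga (x : M) : R :=
  anchor L (sharp P x (al x)) (fun y => Q y [:: be y; ga y])
  + anchor L (sharp Q x (al x)) (fun y => P y [:: be y; ga y])
  - al x (bracket L (fun y => sharp P y (be y)) (fun y => sharp Q y (ga y)) x)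
  - al x (bracket L (fun y => sharp Q y (be y)) (fun y => sharp P y (ga y)) x).

Definition schouten_formula P Q al be ga x : R :=
  schouten_term P Q al be ga x + schouten_term P Q be ga al x
  + schouten_term P Q ga al be x.

Definition vwedge a b : altfield (dual_bundle A) :=
  wedge (vector_alt a) (vector_alt b).
Arguments vwedge : clear implicits.

Lemma homogeneous_vector_alt a : smooth_section a -> homogeneous 1 (vector_alt a).
Proof.
move=> sa; apply: (homogeneous_alt1 (E := dual_bundle A)
  (F := fun x (al : dual_bundle A x) => al (a x))).
  by move=> x c u v; rewrite lfunE /= lfunE.
move=> i k; refine (eq_smooth_in _ _ (sa i k)); first exact: triv_dom_open.
by move=> x ix; rewrite /= coframeE.
Qed.

Lemma vwedgeE a b x (al be : dual_bundle A x) :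
  vwedge a b x [:: al; be] = al (a x) * be (b x) - be (a x) * al (b x).
Proof. by rewrite /vwedge wedge_seq2 /=; ring. Qed.

Lemma vwedge_alt2 a b : vwedge a b =
  alt2 (fun x (al be : dual_bundle A x) => al (a x) * be (b x) - be (a x) * al (b x)).
Proof.
apply: functional_extensionality_dep => x; apply/funext => s.
case: s => [|u [|v [|w s]]].
- by rewrite /vwedge wedge_nil /= mul0r.
- by rewrite /vwedge wedge_seq1 /= mulr0 mul0r addr0.
- exact: vwedgeE.
- by rewrite /vwedge (@wedge_degree _ _ _ _ 1 1)// => y [|? []].
Qed.

Lemma homogeneous_vwedge a b : smooth_section a -> smooth_section b ->
  homogeneous 2 (vwedge a b).
Proof.
move=> sa sb; rewrite vwedge_alt2; apply: homogeneous_alt2.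
- by move=> x c u v w; rewrite !lfunE /= !lfunE /= /GRing.scale /=; ring.
- by move=> x u v; ring.
move=> i k l; have oi := @triv_dom_open _ _ _ A i.
refine (eq_smooth_in oi _ (smooth_inD oi (smooth_inM oi (sa i k) (sb i l))
  (smooth_inM oi (smooth_in_cst (-1)) (smooth_inM oi (sa i l) (sb i k))))).
by move=> x ix; rewrite !coframeE; ring.
Qed.

Lemma sharp_vwedge a b x (al : dual_bundle A x) :
  smooth_section a -> smooth_section b ->
  sharp (vwedge a b) x al = al (a x) *: b x + - al (b x) *: a x.
Proof.
move=> sa sb; apply: sharp_unique; first by case: (homogeneous_vwedge sa sb).
by move=> be; rewrite vwedgeE linearD !linearZ /= /GRing.scale /=; ring.
Qed.

End SchoutenFormula.
Arguments vwedge {R n M A} a b x s.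

Section SchoutenDecomposable.
Context {R : realType} {n : nat} {M : smooth_manifold R n} {A : vector_bundle M}.
Context (L : skew_algebroid A).
Implicit Types (P Q : altfield (dual_bundle A)) (al be ga : section (dual_bundle A)).
Implicit Types (a b : section A).

(** Since $P(\mathcal{L}_a\alpha,\beta)=-(\mathcal{L}_a\alpha)(\sharp_P\beta)$, the Lie
    derivatives of covector fields can be traded for brackets with [sharp P]; one of
    the three derivatives of $P(\alpha,\beta)$ along [a] survives, with sign $-1$. *)
Lemma lie_bivector_sharpE P W a al be x : smooth_section a ->
  homogeneous 2 P -> is_lie_multivector L 2 a P W ->
  smooth_section al -> smooth_section be ->
  W x [:: al x; be x] = - anchor L (a x) (fun y => P y [:: al y; be y])
    - al x (bracket L a (fun y => sharp P y (be y)) x)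
    + be x (bracket L a (fun y => sharp P y (al y)) x).
Proof.
move=> sa hP hW sal sbe; have sP := hP.1.
have ssh d := smooth_sharp sP (al := d).
rewrite (lie_bivectorE _ sa hP hW)// (alt_skew (lie_form1 L a al x) _ sP).
rewrite -!sharpE//.
rewrite (@lie_form1E _ _ _ _ L _ _ (fun y => sharp P y (be y)))//; last exact: ssh.
rewrite (@lie_form1E _ _ _ _ L _ _ (fun y => sharp P y (al y)))//; last exact: ssh.
rewrite /lie_pairing.
have -> : anchor L (a x) (fun y => al y (sharp P y (be y)))
    = - anchor L (a x) (fun y => P y [:: al y; be y]).
  rewrite -anchorN; last exact: smooth_alt2_eval.
  by congr anchor; apply/funext => y; rewrite sharpE// alt_skew.
have -> : (fun y => be y (sharp P y (al y))) = (fun y => P y [:: al y; be y]).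
  by apply/funext => y; rewrite sharpE.
ring.
Qed.

Lemma bracket_sharp_vwedge (eta : section (dual_bundle A)) c a b ga x :
  smooth_section c -> smooth_section a -> smooth_section b -> smooth_section ga ->
  eta x (bracket L c (fun y => sharp (vwedge a b) y (ga y)) x)
  = ga x (a x) * eta x (bracket L c b x)
    + anchor L (c x) (fun y => ga y (a y)) * eta x (b x)
    - ga x (b x) * eta x (bracket L c a x)
    - anchor L (c x) (fun y => ga y (b y)) * eta x (a x).
Proof.
move=> sc sa sb sga; have se := @smooth_covector_eval _ _ _ A.
have -> : (fun y => sharp (vwedge a b) y (ga y))
    = (fun y => ga y (a y) *: b y + - ga y (b y) *: a y).
  by apply: functional_extensionality_dep => y; rewrite sharp_vwedge.
have [sga1 sgb] := (se _ _ sga sa, smooth_funN (se _ _ sga sb)).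
rewrite bracketD//; [|exact: smooth_sectionZ..].
rewrite !bracket_leibniz//; rewrite anchorN; last exact: se.
by rewrite !linearD !linearZ /= /GRing.scale /=; ring.
Qed.

(** By the Leibniz rule $[P,a\wedge b]=\mathcal{L}_aP\wedge b-a\wedge\mathcal{L}_bP$,
    with both Lie derivatives given by [lie_bivector_sharpE]. On the other
    side, $\sharp_{a\wedge b}\gamma=\gamma(a)b-\gamma(b)a$ makes every bracket explicit. *)
Lemma schouten_decomposable SN P a b al be ga x :
  schouten_nijenhuis L SN -> homogeneous 2 P ->
  smooth_section a -> smooth_section b -> smooth_section al ->
  smooth_section be -> smooth_section ga ->
  SN P (vwedge a b) x [:: al x; be x; ga x]
  = schouten_formula L P (vwedge a b) al be ga x.
Proof.
move=> hSN hP sa sb sal sbe sga; have sP := hP.1.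
have [h1a h1b] := (homogeneous_vector_alt sa, homogeneous_vector_alt sb).
have ssh d := smooth_sharp sP (al := d).
have se := @smooth_covector_eval _ _ _ A.
have hLa := SN_lie hSN sa hP; have hLb := SN_lie hSN sb hP.
have SNa u v : SN P (vector_alt a) x [:: u; v] = SN (vector_alt a) P x [:: u; v].
  by rewrite (SN_sym hSN hP h1a) expr2 mulrNN !mul1r.
have SNb u v : SN P (vector_alt b) x [:: u; v] = SN (vector_alt b) P x [:: u; v].
  by rewrite (SN_sym hSN hP h1b) expr2 mulrNN !mul1r.
rewrite /vwedge (SN_leibniz hSN hP h1a h1b) !wedge_seq3 /= -/(vwedge a b).
rewrite !SNa !SNb !(lie_bivector_sharpE _ sa hP hLa)//.
rewrite !(lie_bivector_sharpE _ sb hP hLb)//.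
have termE (u v w : section (dual_bundle A)) :
    smooth_section u -> smooth_section v -> smooth_section w ->
  schouten_term L P (vwedge a b) u v w x =
    anchor L (sharp P x (u x)) (fun y => v y (a y)) * w x (b x)
    + anchor L (sharp P x (u x)) (fun y => w y (b y)) * v x (a x)
    - anchor L (sharp P x (u x)) (fun y => w y (a y)) * v x (b x)
    - anchor L (sharp P x (u x)) (fun y => v y (b y)) * w x (a x)
    + u x (a x) * anchor L (b x) (fun y => P y [:: v y; w y])
    - u x (b x) * anchor L (a x) (fun y => P y [:: v y; w y])
    - (w x (a x) * - u x (bracket L b (fun y => sharp P y (v y)) x)
      + anchor L (sharp P x (v x)) (fun y => w y (a y)) * u x (b x)
      - w x (b x) * - u x (bracket L a (fun y => sharp P y (v y)) x)
      - anchor L (sharp P x (v x)) (fun y => w y (b y)) * u x (a x))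
    + (v x (a x) * - u x (bracket L b (fun y => sharp P y (w y)) x)
      + anchor L (sharp P x (w x)) (fun y => v y (a y)) * u x (b x)
      - v x (b x) * - u x (bracket L a (fun y => sharp P y (w y)) x)
      - anchor L (sharp P x (w x)) (fun y => v y (b y)) * u x (a x)).
  move=> su sv sw; rewrite /schouten_term.
  have sQ := (homogeneous_vwedge sa sb).1.
  rewrite [X in _ - u x X](bracket_skew L)//; [|exact: smooth_sharp..].
  rewrite linearN /= !bracket_sharp_vwedge//; [|exact: ssh..].
  rewrite ![bracket L (fun y => sharp P y _) _ x](bracket_skew L)//; [|exact: ssh..].
  rewrite !linearN /=.
  have -> : (fun y => vwedge a b y [:: v y; w y])
      = (fun y => v y (a y) * w y (b y) + - (w y (a y) * v y (b y))).
    by apply/funext => y; rewrite vwedgeE.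
  have [va wb] := (se _ _ sv sa, se _ _ sw sb).
  have [wa vb] := (se _ _ sw sa, se _ _ sv sb).
  have [p1 p2] := (smooth_funM va wb, smooth_funM wa vb).
  have [p3 p4] := (smooth_funN p2, smooth_alt2_eval sP sv sw).
  rewrite anchorD// anchorN// !anchorM// sharp_vwedge// anchor_vectorD//.
  by rewrite !anchor_vectorZ//; ring.
rewrite /schouten_formula !termE//.
have skP u v : smooth_section u -> smooth_section v -> forall c : section A,
  anchor L (c x) (fun y => P y [:: u y; v y])
  = - anchor L (c x) (fun y => P y [:: v y; u y]).
  move=> su sv c; rewrite -anchorN; last exact: smooth_alt2_eval.
  by congr anchor; apply/funext => y; rewrite alt_skew.
(* The cyclic sum produces P(ga, al) where the wedge product has P(al, ga). *)
rewrite !(skP ga al)//.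
ring.
Qed.

End SchoutenDecomposable.

Section SchoutenLocality.
Context {R : realType} {n : nat} {M : smooth_manifold R n} {A : vector_bundle M}.
Context (L : skew_algebroid A).
Implicit Types (P Q W : altfield (dual_bundle A)) (al be ga : section (dual_bundle A)).

Lemma schouten_formula_add P c Q W al be ga x :
  homogeneous 2 P -> homogeneous 2 Q -> homogeneous 2 W ->
  smooth_section al -> smooth_section be -> smooth_section ga ->
  schouten_formula L P (alt_add c Q W) al be ga x
  = c * schouten_formula L P Q al be ga x + schouten_formula L P W al be ga x.
Proof.
move=> hP hQ hW sal sbe sga.
have [sP sQ sW] := And3 hP.1 hQ.1 hW.1.
have sQW := (homogeneous_alt_add c hQ hW).1.
have addE y (u : dual_bundle A y) :
    sharp (alt_add c Q W) y u = c *: sharp Q y u + sharp W y u.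
  apply: sharp_unique => // v.
  by rewrite linearD linearZ /= !sharpE.
have addsE (u : section (dual_bundle A)) :
    (fun y => sharp (alt_add c Q W) y (u y))
    = (fun y => c *: sharp Q y (u y) + sharp W y (u y)).
  by apply: functional_extensionality_dep => y.
have ssh P' d := @smooth_sharp _ _ _ A P' d.
have s2 P' (u v : section (dual_bundle A)) := @smooth_alt2_eval _ _ _ _ P' u v.
have termE (u v w : section (dual_bundle A)) :
    smooth_section u -> smooth_section v -> smooth_section w ->
  schouten_term L P (alt_add c Q W) u v w x =
  c * schouten_term L P Q u v w x + schouten_term L P W u v w x.
  move=> su sv sw; rewrite /schouten_term !addsE addE.
  have [sPv sPw] := (ssh _ _ sP sv, ssh _ _ sP sw).
  have [sQv sQw] := (ssh _ _ sQ sv, ssh _ _ sQ sw).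
  have [sWv sWw] := (ssh _ _ sW sv, ssh _ _ sW sw).
  rewrite bracket_linear//.
  have scv : smooth_section (fun y => c *: sharp Q y (v y) + sharp W y (v y)).
    by rewrite -addsE; exact: ssh.
  rewrite [X in _ - u x X](bracket_skew L)// bracket_linear//.
  rewrite [bracket L (fun y => sharp Q y (v y)) _ x](bracket_skew L)//.
  rewrite [bracket L (fun y => sharp W y (v y)) _ x](bracket_skew L)//.
  rewrite anchor_linear; last exact: s2.
  rewrite /alt_add (tangent_linear (anchor_tangent L (sharp P x (u x)))).
  - by rewrite !linearN /= !covectorP; ring.
  - exact: s2.
  - exact: s2.
by rewrite /schouten_formula !termE//; ring.
Qed.

Lemma wedge_alt0 (u : M -> R) Q x s : homogeneous 2 Q ->
  wedge (alt0 u) Q x s = u x * Q x s.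
Proof.
move=> [sQ hQ].
case: s => [|a [|b [|c s]]].
- by rewrite wedge_nil.
- by rewrite wedge_seq1 /= mul0r add0r.
- by rewrite wedge_seq2 /= !mul0r subr0 !add0r.
- rewrite (@wedge_degree _ _ _ _ 0 2)//; last by move=> y [].
  by rewrite hQ ?mulr0.
Qed.

Lemma homogeneous_wedge_alt0 (u : M -> R) Q : smooth_fun u -> homogeneous 2 Q ->
  homogeneous 2 (wedge (alt0 u) Q).
Proof.
move=> su hQ; have [sQ h0] := hQ.
split; last by move=> x s sz; rewrite wedge_alt0// h0// mulr0.
split.
- by move=> x s1 s2 c a b; rewrite !wedge_alt0// (alt_linear sQ); ring.
- by move=> x s1 s2 s3 a; rewrite wedge_alt0// (alt_alternating sQ) mulr0.
- move=> i ks; have oi := @triv_dom_open _ _ _ A i.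
  refine (eq_smooth_in oi _ (smooth_inM oi (smooth_fun_in su) (alt_smooth sQ ks))).
  by move=> x _; rewrite wedge_alt0.
Qed.

(** The formula is of first order in [Q], so a factor [u] that equals 1 and has
    vanishing differential at [x] is invisible there. *)
Lemma schouten_formula_cutoff P (u : M -> R) Q al be ga x :
  homogeneous 2 P -> homogeneous 2 Q -> smooth_fun u ->
  smooth_section al -> smooth_section be -> smooth_section ga ->
  u x = 1 -> (forall v : A x, anchor L v u = 0) ->
  schouten_formula L P (wedge (alt0 u) Q) al be ga x
  = schouten_formula L P Q al be ga x.
Proof.
move=> hP hQ su sal sbe sga ux du.
have [sP sQ] := (hP.1, hQ.1); have hU := homogeneous_wedge_alt0 su hQ.
have uE y (a : dual_bundle A y) : sharp (wedge (alt0 u) Q) y a = u y *: sharp Q y a.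
  apply: sharp_unique => [|v]; first exact: hU.1.
  by rewrite linearZ /= sharpE// wedge_alt0.
have usE (a : section (dual_bundle A)) :
    (fun y => sharp (wedge (alt0 u) Q) y (a y))
    = (fun y => u y *: sharp Q y (a y)).
  by apply: functional_extensionality_dep => y.
have ssh P' d := @smooth_sharp _ _ _ A P' d.
have s2 P' (a v : section (dual_bundle A)) := @smooth_alt2_eval _ _ _ _ P' a v.
have termE (a v w : section (dual_bundle A)) :
    smooth_section a -> smooth_section v -> smooth_section w ->
  schouten_term L P (wedge (alt0 u) Q) a v w x = schouten_term L P Q a v w x.
  move=> sa sv sw; rewrite /schouten_term !usE uE.
  have [sPv sPw] := (ssh _ _ sP sv, ssh _ _ sP sw).
  have [sQv sQw] := (ssh _ _ sQ sv, ssh _ _ sQ sw).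
  have suv := smooth_sectionZ su sQv.
  rewrite bracket_leibniz// [X in _ - a x X](bracket_skew L)// bracket_leibniz//.
  rewrite [bracket L (fun y => sharp Q y (v y)) _ x](bracket_skew L)//.
  have -> : (fun y => wedge (alt0 u) Q y [:: v y; w y])
      = (fun y => u y * Q y [:: v y; w y]).
    by apply/funext => y; rewrite wedge_alt0.
  have [s2P s2Q] := (s2 _ _ _ sP sv sw, s2 _ _ _ sQ sv sw).
  by rewrite anchorM// !du ux !scale1r !scale0r !addr0 mul1r mulr0 addr0.
by rewrite /schouten_formula !termE.
Qed.

(** The function $w(2-w)=1-(1-w)^2$ is critical wherever [w] is 1. Applied to
    $2w-w\wedge w$, the Leibniz rule gives $[P,w(2-w)]=2(1-w)[P,w]$, which vanishes
    at [x] although $[P,w]$ itself may not. *)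
Lemma SN_cutoff SN P (w : M -> R) Q x (al be ga : dual_bundle A x) :
  schouten_nijenhuis L SN -> homogeneous 2 P -> homogeneous 2 Q -> smooth_fun w ->
  w x = 1 ->
  SN P (wedge (alt0 (fun y => w y * (2 - w y))) Q) x [:: al; be; ga]
  = SN P Q x [:: al; be; ga].
Proof.
move=> hSN hP hQ sw wx; have hw := homogeneous_alt0 (E := dual_bundle A) sw.
set u := fun y => _; have su : smooth_fun u.
  apply: smooth_funM => //; apply: smooth_funD; last exact: smooth_funN.
  exact: smooth_in_cst.
have hu := homogeneous_alt0 (E := dual_bundle A) su.
pose w2 := wedge (alt0 w) (alt0 w) : altfield (dual_bundle A).
have w2E : w2 = alt0 (fun y => w y * w y).
  apply: functional_extensionality_dep => y; apply/funext => -[|a s].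
    by rewrite /w2 wedge_nil.
  by rewrite /w2 (@wedge_degree _ _ _ _ 0 0)// => z [].
have hw2 : homogeneous 0 w2.
  by rewrite w2E; apply: homogeneous_alt0; exact: smooth_funM.
have uE : alt0 u = alt_add (-1) w2 (alt_add 1 (alt0 w) (alt0 w)).
  apply: functional_extensionality_dep => y; apply/funext => s.
  rewrite w2E /alt_add; case: s => [|a s] /=; last by rewrite !mulr0 !addr0.
  by rewrite /u; ring.
have SNu a : SN P (alt0 u) x [:: a] = 0.
  rewrite uE (SN_linearr hSN (-1) hP hw2 (homogeneous_alt_add 1 hw hw)).
  rewrite (SN_linearr hSN 1 hP hw hw) /alt_add (SN_leibniz hSN hP hw hw).
  rewrite !wedge_seq1 /= wx.
  ring.
rewrite (SN_leibniz hSN hP hu hQ) !wedge_seq3 /= !SNu muln0 expr0.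
have ux : u x = 1 by rewrite /u wx; ring.
have h1 : homogeneous 1 (SN P (alt0 u)) by exact: (SN_degree hSN hP hu).
have [_ h1'] := h1; have [_ hQ'] := hQ.
rewrite !(h1' _ [:: _; _])// (h1' _ [::])// !(hQ' _ [::])// ux; ring.
Qed.

(** Both sides are additive in [Q], agree on decomposable bivector fields and
    ignore a factor $u=w(2-w)$. By [local_resolution],
    $uQ=\frac12\sum_k e_k\wedge(2-w)\,\sharp_Q\varepsilon_k$ is a sum of decomposables; the
    factor $\frac12$ is there because $\sum_k e_k\wedge\sharp_Q\varepsilon_k$ counts each
    component of [Q] twice. *)
Lemma SN_schouten_formula SN P Q al be ga x :
  schouten_nijenhuis L SN -> homogeneous 2 P -> homogeneous 2 Q ->
  smooth_section al -> smooth_section be -> smooth_section ga ->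
  SN P Q x [:: al x; be x; ga x] = schouten_formula L P Q al be ga x.
Proof.
move=> hSN hP hQ sal sbe sga; have sQ := hQ.1.
have [w [e [eps [sw wx se seps we]]]] := local_resolution (A := A) x.
pose u y := w y * (2 - w y).
have s2w : smooth_fun (fun y => 2 - w y).
  by apply: smooth_funD; [exact: smooth_in_cst | exact: smooth_funN].
have su : smooth_fun u by exact: smooth_funM.
rewrite -(SN_cutoff _ _ _ hSN hP hQ sw wx).
rewrite -(@schouten_formula_cutoff P u)//; last 2 first.
- by rewrite /u wx; ring.
- move=> v; rewrite anchorM// anchorD//; [|exact: smooth_in_cst|exact: smooth_funN].
  by rewrite anchor_cst anchorN// wx; ring.
pose X k : section A := fun y => (2^-1 * (2 - w y)) *: sharp Q y (eps k y).
have sX k : smooth_section (X k).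
  apply: smooth_sectionZ; last exact: smooth_sharp.
  by apply: smooth_funM => //; exact: smooth_in_cst.
pose T r := foldr (fun k W => alt_add 1 (vwedge (e k) (X k)) W)
  (alt_zero (dual_bundle A)) r.
have hV k := homogeneous_vwedge (se k) (sX k).
have hT r : homogeneous 2 (T r).
  elim: r => [|k r IH] /=; first exact: homogeneous_alt_zero.
  exact: homogeneous_alt_add.
have TE r y a b :
    T r y [:: a; b] = \sum_(k <- r) (a (e k y) * b (X k y) - b (e k y) * a (X k y)).
  elim: r => [|k r IH]; first by rewrite big_nil.
  by rewrite big_cons -IH /= /alt_add vwedgeE mul1r.
have epsE y (a : dual_bundle A y) : \sum_k a (e k y) *: eps k y = w y *: a.
  apply/lfunP => v; rewrite sum_lfunE lfunE /= -[RHS]linearZ we linear_sum.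
  by apply: eq_bigr => k _; rewrite lfunE /= linearZ /=; exact: mulrC.
have QE y (a b : dual_bundle A y) :
    \sum_k a (e k y) * b (X k y) = 2^-1 * u y * Q y [:: a; b].
  have -> : 2^-1 * u y * Q y [:: a; b] = 2^-1 * (2 - w y) * Q y [:: w y *: a; b].
    by rewrite (alt_slotZ sQ [::]) /u /=; ring.
  rewrite -epsE (alt_slot_sum sQ [::]) mulr_sumr; apply: eq_bigr => k _.
  rewrite (alt_slotZ sQ [::]) /X linearZ /= sharpE//.
  by rewrite /GRing.scale /=; ring.
have -> : wedge (alt0 u) Q = T (index_enum _).
  apply: functional_extensionality_dep => y; apply/funext => s.
  rewrite wedge_alt0//; have [s2|/eqP s2] := eqVneq (size s) 2; last first.
    by rewrite hQ.2// (hT _).2// mulr0.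
  case: s s2 => [|a [|b []]]//= _; rewrite TE sumrB !QE (alt_skew b a sQ).
  by field.
have SN0 : SN P (alt_zero (dual_bundle A)) x [:: al x; be x; ga x]
    = schouten_formula L P (alt_zero (dual_bundle A)) al be ga x.
  have h0 := homogeneous_alt_zero (E := dual_bundle A) 2.
  have -> : alt_zero (dual_bundle A)
      = alt_add (-1) (alt_zero (dual_bundle A)) (alt_zero (dual_bundle A)).
    apply: functional_extensionality_dep => y; apply/funext => s.
    by rewrite /alt_add /alt_zero mulr0 addr0.
  rewrite schouten_formula_add// (SN_linearr hSN (-1) hP h0 h0) /alt_add.
  by ring.
elim: (index_enum _) => [//|k r IH] /=.
rewrite schouten_formula_add// (SN_linearr hSN 1 hP (hV k) (hT r)) /alt_add -IH.
by rewrite (schouten_decomposable _ hSN hP (se k) (sX k) sal sbe sga).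
Qed.

End SchoutenLocality.

(** * Compatible triples *)

Section JacobiTensor.
Context {R : realType} {n : nat} {M : smooth_manifold R n} {A : vector_bundle M}.
Context (L : skew_algebroid A).
Context (g : forall x : M, 'Hom(A x, dual_bundle A x)).
Context {Pi : altfield (dual_bundle A)} {xi : section A}.
Arguments Pi : clear implicits.
Hypotheses (hPi : homogeneous 2 Pi) (hxi : smooth_section xi).
Implicit Types (al be ga : section (dual_bundle A)).

Let sPi : smooth_alternating Pi := hPi.1.
Let sharp_sec al := fun y => sharp Pi y (al y).
Let ssh al : smooth_section al -> smooth_section (sharp_sec al) := smooth_sharp sPi.

Lemma d_anchorE f x (v : A x) : smooth_fun f -> d_anchor L f x v = anchor L v f.
Proof.
move=> sf; have lin : linear (fun v : A x => anchor L v f : R^o).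
  by move=> c u w; exact: anchor_linear.
pose T : {linear A x -> R^o} := HB.pack (fun v : A x => anchor L v f : R^o)
  (GRing.isLinear.Build _ _ _ _ _ lin).
by rewrite /d_anchor (_ : (fun v : A x => _) = T)// lfunE.
Qed.

Lemma bracket_PiE al be c x : smooth_section al -> smooth_section be ->
  smooth_section c ->
  bracket_Pi L Pi al be x (c x) = lie_pairing L (sharp_sec al) be c x
    - lie_pairing L (sharp_sec be) al c x
    - anchor L (c x) (fun y => Pi y [:: al y; be y]).
Proof.
move=> sal sbe sc; have [sa sb] := (ssh sal, ssh sbe).
rewrite /bracket_Pi add_lfunE opp_lfunE add_lfunE opp_lfunE !lie_form1E//.
by rewrite d_anchorE//; exact: smooth_alt2_eval.
Qed.

Lemma Pi_bracket_Pi al be ga x : smooth_section al -> smooth_section be ->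
  smooth_section ga ->
  Pi x [:: bracket_Pi L Pi al be x; ga x] =
    anchor L (sharp Pi x (al x)) (fun y => Pi y [:: be y; ga y])
    + anchor L (sharp Pi x (be x)) (fun y => Pi y [:: ga y; al y])
    + anchor L (sharp Pi x (ga x)) (fun y => Pi y [:: al y; be y])
    + be x (bracket L (sharp_sec al) (sharp_sec ga) x)
    - al x (bracket L (sharp_sec be) (sharp_sec ga) x).
Proof.
move=> sal sbe sga; rewrite (alt_skew _ _ sPi) -sharpE//.
have -> := bracket_PiE x sal sbe (ssh sga); rewrite /lie_pairing /sharp_sec.
have -> : (fun y => al y (sharp Pi y (ga y))) = (fun y => Pi y [:: ga y; al y]).
  by apply/funext => y; rewrite sharpE.
have -> : anchor L (sharp Pi x (al x)) (fun y => be y (sharp Pi y (ga y)))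
    = - anchor L (sharp Pi x (al x)) (fun y => Pi y [:: be y; ga y]).
  rewrite -anchorN; last exact: smooth_alt2_eval.
  by congr anchor; apply/funext => y; rewrite sharpE// alt_skew.
ring.
Qed.

(** By [Pi_bracket_Pi], each derivative $\rho(\sharp\alpha)\cdot\Pi(\beta,\gamma)$ occurs in
    all three terms that are subtracted, and once with a positive sign; the net
    coefficient $-2$ is opposite to the one in the Schouten bracket. *)
Lemma cyclic_bracket_Pi al be ga x : smooth_section al -> smooth_section be ->
  smooth_section ga ->
  (anchor L (sharp Pi x (al x)) (fun y => Pi y [:: be y; ga y])
     - Pi x [:: bracket_Pi L Pi al be x; ga x])
  + (anchor L (sharp Pi x (be x)) (fun y => Pi y [:: ga y; al y])
     - Pi x [:: bracket_Pi L Pi be ga x; al x])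
  + (anchor L (sharp Pi x (ga x)) (fun y => Pi y [:: al y; be y])
     - Pi x [:: bracket_Pi L Pi ga al x; be x])
  = - schouten_formula L Pi Pi al be ga x.
Proof.
move=> sal sbe sga; rewrite !Pi_bracket_Pi//.
have brC (u v w : section (dual_bundle A)) : smooth_section v -> smooth_section w ->
    u x (bracket L (sharp_sec v) (sharp_sec w) x)
    = - u x (bracket L (sharp_sec w) (sharp_sec v) x).
  by move=> sv sw; rewrite (bracket_skew L (ssh sv) (ssh sw)) linearN.
rewrite (brC be al ga)// (brC ga be al)// (brC al ga be)//.
rewrite /schouten_formula /schouten_term -!/(sharp_sec _); ring.
Qed.

Lemma Pi_bracket_xi al be ga x : smooth_section al -> smooth_section be ->
  smooth_section ga ->
  Pi x [:: bracket_xi L g Pi xi al be x; ga x] =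
    Pi x [:: bracket_Pi L Pi al be x; ga x]
    + al x (xi x) * (Pi x [:: lie_form1 L xi be x; ga x] - Pi x [:: be x; ga x])
    - be x (xi x) * (Pi x [:: lie_form1 L xi al x; ga x] - Pi x [:: al x; ga x])
    - Pi x [:: al x; be x] * Pi x [:: lambda g Pi xi x; ga x].
Proof.
move=> sal sbe sga; pose F u := Pi x [:: u; ga x].
have FD u v : F (u + v) = F u + F v by exact: (alt_slotD sPi [::]).
have FZ c u : F (c *: u) = c * F u by exact: (alt_slotZ sPi [::]).
have FN u : F (- u) = - F u by rewrite -scaleN1r FZ mulN1r.
have FE a b c d e l (r s t : R) :
    F (a + r *: (b - c) - s *: (d - e) - t *: l)
    = F a + r * (F b - F c) - s * (F d - F e) - t * F l.
  by rewrite !(FD, FN, FZ).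
exact: FE.
Qed.

(** In the cyclic sum the covariant derivatives occur in differences
    $\mathcal{D}_\alpha\beta-\mathcal{D}_\beta\alpha$, which are brackets since the torsion
    vanishes. *)
Lemma levi_civita_cyclic D al be ga x :
  levi_civita (anchor_xi L Pi xi) (bracket_xi L g Pi xi) (@cometric _ _ _ _ g) D ->
  smooth_section al -> smooth_section be -> smooth_section ga ->
  (anchor_xi L Pi xi (al x) (fun y => Pi y [:: be y; ga y])
     - Pi x [:: D al be x; ga x] - Pi x [:: be x; D al ga x])
  + (anchor_xi L Pi xi (be x) (fun y => Pi y [:: ga y; al y])
     - Pi x [:: D be ga x; al x] - Pi x [:: ga x; D be al x])
  + (anchor_xi L Pi xi (ga x) (fun y => Pi y [:: al y; be y])
     - Pi x [:: D ga al x; be x] - Pi x [:: al x; D ga be x])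
  = (anchor_xi L Pi xi (al x) (fun y => Pi y [:: be y; ga y])
     - Pi x [:: bracket_xi L g Pi xi al be x; ga x])
  + (anchor_xi L Pi xi (be x) (fun y => Pi y [:: ga y; al y])
     - Pi x [:: bracket_xi L g Pi xi be ga x; al x])
  + (anchor_xi L Pi xi (ga x) (fun y => Pi y [:: al y; be y])
     - Pi x [:: bracket_xi L g Pi xi ga al x; be x]).
Proof.
move=> hD sal sbe sga.
have torsion (u v w : section (dual_bundle A)) : smooth_section u -> smooth_section v ->
    Pi x [:: bracket_xi L g Pi xi u v x; w x]
    = Pi x [:: D u v x; w x] - Pi x [:: D v u x; w x].
  move=> su sv; rewrite -(conn_torsion hD su sv) (alt_slotD sPi [::]) -scaleN1r.
  by rewrite (alt_slotZ sPi [::]) mulN1r.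
rewrite !torsion//.
rewrite (alt_skew (be x) (D al ga x) sPi) (alt_skew (ga x) (D be al x) sPi).
by rewrite (alt_skew (al x) (D ga be x) sPi); ring.
Qed.

(** In the cyclic sum of the compatibility condition the terms with the cometric
    cancel by symmetry and the others add up to $\xi\wedge\Pi$. On the left, the
    terms with $\mathcal{L}_\xi$ cancel because $\Pi$ is invariant along $\xi$, leaving
    $-[\Pi,\Pi]+2\xi\wedge\Pi+\sharp_\Pi(\lambda)\wedge\Pi$. *)
Lemma compatible_schouten D al be ga x : pseudo_riemannian g ->
  levi_civita (anchor_xi L Pi xi) (bracket_xi L g Pi xi) (@cometric _ _ _ _ g) D ->
  is_lie_multivector L 2 xi Pi (alt_zero (dual_bundle A)) ->
  compatible L g Pi xi D ->
  smooth_section al -> smooth_section be -> smooth_section ga ->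
  schouten_formula L Pi Pi al be ga x =
    wedge (vector_alt xi) Pi x [:: al x; be x; ga x]
    + wedge (vector_alt (fun y => sharp Pi y (lambda g Pi xi y))) Pi x
        [:: al x; be x; ga x].
Proof.
move=> hg hD hLie hcomp sal sbe sga.
have := levi_civita_cyclic x hD sal sbe sga; rewrite !hcomp//.
rewrite !Pi_bracket_xi// /anchor_xi /sharp_xi.
have s2 u v := @smooth_alt2_eval _ _ _ _ Pi u v sPi.
rewrite !anchor_vectorD ?anchor_vectorZ; do ?exact: s2.
have gC (u v : dual_bundle A x) : cometric g u v = cometric g v u.
  by rewrite /cometric (Defs.metric_sym hg).
have Lie (u v : section (dual_bundle A)) : smooth_section u -> smooth_section v ->
    anchor L (xi x) (fun y => Pi y [:: u y; v y])
    = Pi x [:: lie_form1 L xi u x; v x] - Pi x [:: lie_form1 L xi v x; u x].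
  move=> su sv; have := lie_bivectorE x hxi hPi hLie su sv.
  rewrite /alt_zero (alt_skew (u x) (lie_form1 L xi v x) sPi); lra.
rewrite !Lie//.
have := cyclic_bracket_Pi x sal sbe sga.
have deg2 s : size s <> 2 -> Pi x s = 0 by exact: hPi.2.
rewrite !wedge_seq3 /= !sharpE//.
rewrite !(deg2 [:: _])// !(deg2 [::])//.
rewrite (gC (be x) (al x)) (gC (ga x) (al x)) (gC (ga x) (be x)).
rewrite (alt_skew (be x) (al x) sPi) (alt_skew (ga x) (al x) sPi).
rewrite (alt_skew (ga x) (be x) sPi).
lra.
Qed.

End JacobiTensor.

Theorem theorem4p2 (R : realType) (n : nat) (M : smooth_manifold R n)
  (A : vector_bundle M) (L : skew_algebroid A)
  (g : forall x : M, 'Hom(A x, dual_bundle A x)) (hg : pseudo_riemannian g)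
  (Pi : altfield (dual_bundle A)) (hPi : homogeneous 2 Pi)
  (xi : section A) (hxi : smooth_section xi)
  (SN : altfield (dual_bundle A) -> altfield (dual_bundle A) ->
        altfield (dual_bundle A))
  (hSN : schouten_nijenhuis L SN)
  (D : section (dual_bundle A) -> section (dual_bundle A) ->
       section (dual_bundle A))
  (hD : levi_civita (anchor_xi L Pi xi) (bracket_xi L g Pi xi)
          (@cometric _ _ _ _ g) D)
  (hLie : is_lie_multivector L 2 xi Pi (alt_zero (dual_bundle A)))
  (hcomp : compatible L g Pi xi D) :
  jacobi_structure L SN Pi xi <->
  (forall x s,
     wedge (vector_alt (fun y => xi y - sharp Pi y (lambda g Pi xi y))) Pi x s
     = 0).
Proof.
have sPi := hPi.1.
have vec_sub (a b : section A) x (u v w : dual_bundle A x) :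
    wedge (vector_alt (fun y => a y - b y)) Pi x [:: u; v; w]
    = wedge (vector_alt a) Pi x [:: u; v; w] - wedge (vector_alt b) Pi x [:: u; v; w].
  by rewrite !wedge_seq3 /= !linearB /=; ring.
have SNE x (u v w : dual_bundle A x) : SN Pi Pi x [:: u; v; w]
    = wedge (vector_alt xi) Pi x [:: u; v; w]
      + wedge (vector_alt (fun y => sharp Pi y (lambda g Pi xi y))) Pi x [:: u; v; w].
  have [al sal <-] := smooth_section_through u.
  have [be sbe <-] := smooth_section_through v.
  have [ga sga <-] := smooth_section_through w.
  rewrite (SN_schouten_formula _ hSN hPi hPi sal sbe sga).
  by rewrite (compatible_schouten hPi hxi x hg hD hLie).
have wedge_off a x s : size s <> 3 -> wedge (vector_alt a) Pi x s = 0.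
  apply: (@wedge_degree _ _ _ _ 1 2); last exact: hPi.2.
  by move=> y [|? []].
split=> [[SN2 _] x s|W0].
  have [|/eqP s3] := eqVneq (size s) 3; last exact: wedge_off.
  case: s => [|u [|v [|w []]]]//= _.
  by have := SN2 x [:: u; v; w]; rewrite SNE vec_sub; lra.
split=> // x s; have [|/eqP s3] := eqVneq (size s) 3; last first.
  by rewrite wedge_off// mulr0 (SN_degree hSN hPi hPi).2.
case: s => [|u [|v [|w []]]]//= _.
by have := W0 x [:: u; v; w]; rewrite SNE vec_sub; lra.
Qed.
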